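(* Let $R\in(0,+\infty]$, $s_+>0$, $p,q\in\mathbb{R}$ with $q>0$, and let $F:\mathbb{R}\to\mathbb{R}$ be a $C^1$ function such that $F(0)=F(s_+)=0$, $F'(s_+)>0$, $F(t)<0$ for $t\in(0,s_+)$, and $F(t)\ge 0$ for $t\in(s_+,+\infty)$. Then there exists a non-negative solution $u$ of the boundary value problem $$u''(r)+\frac{p}{r}u'(r)-\frac{q}{r^2}u(r)=F(u(r))\ \text{ in }(0,R),\qquad u(0)=0,\quad u(R)=s_+,$$ and it is unique in the class of non-negative solutions. Moreover, this solution is strictly increasing.
   Context: A solution is a function $u\in C^2(0,R)$ satisfying the ODE pointwise in $(0,R)$; the boundary conditions mean $\lim_{r\to0^+}u(r)=0$ and $\lim_{r\to R^-}u(r)=s_+$ (so $u(+\infty):=\lim_{r\to+\infty}u(r)=s_+$ if $R=+\infty$). *)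

(* Defs.v *)
(* Stdlib reals with Coquelicot. *)
From Stdlib Require Import Reals.
From Coquelicot Require Import Coquelicot.
Open Scope R_scope.

Definition is_C1 (F : R -> R) : Prop :=
  forall t : R, ex_derive F t /\ continuous (Derive F) t.

Definition in_interval (b : Rbar) (r : R) : Prop := 0 < r /\ Rbar_lt r b.

(* Since [Derive] is total, every lower-order derivability is required as well;
   (0, b) is open, so [u] need not be regular at 0 or at [b]. *)
Definition is_C2_on (b : Rbar) (u : R -> R) : Prop :=
  forall r : R, in_interval b r ->
    ex_derive u r /\ ex_derive (Derive u) r /\ continuous (Derive (Derive u)) r.

(* For finite [b] this filter unfolds to [at_left b]; for [b = p_infty] the
   restriction is vacuous and it is the usual filter at infinity. *)
Definition left_of (b : Rbar) : (R -> Prop) -> Prop :=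
  within (fun r : R => Rbar_lt r b) (Rbar_locally b).

(* Only the values of [u] on (0, b) matter. *)
Definition is_solution (b : Rbar) (s p q : R) (F : R -> R) (u : R -> R) : Prop :=
  is_C2_on b u /\
  (forall r : R, in_interval b r ->
     Derive (Derive u) r + p / r * Derive u r - q / r ^ 2 * u r = F (u r)) /\
  filterlim u (at_right 0) (locally 0) /\
  filterlim u (left_of b) (locally s).

Definition is_nonneg_solution (b : Rbar) (s p q : R) (F : R -> R) (u : R -> R)
  : Prop :=
  is_solution b s p q F u /\ forall r : R, in_interval b r -> 0 <= u r.

Definition strictly_increasing_on (b : Rbar) (u : R -> R) : Prop :=
  forall r1 r2 : R,
    in_interval b r1 -> in_interval b r2 -> r1 < r2 -> u r1 < u r2.

(* Main.v *)
(* In the variable [t = ln r], with [k = p - 1], the equation becomes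
   [U'' + k U' - q U = exp (2 t) F U] on (-oo, ln b), and dilations of [r] become
   translations of [t].

   Uniqueness and monotonicity come from sliding: for two solutions [U], [V] one
   shows [V t <= U (t + a)] for all [a >= 0].  A negative minimum of
   [U (t + a) - V t] cannot occur near -oo, where [q] beats the Lipschitz
   constant of [exp (2 t) F], nor where both functions are close to [s], where
   [F] is nondecreasing; so at the largest [a] violating the inequality the graphs
   touch, which contradicts [F < 0] on (0, s).

   For existence, the Dirichlet problem on a compact interval with boundary
   values [s] has a greatest solution; letting the left end decrease to -oo gives
   a decreasing sequence and hence the case of finite [b].  For [b = +oo] one
   lets [b] increase: the solutions decrease, and the energy
   [u'^2 / 2 - (RInt F 0 u)], which is almost constant for large [r] and at least
   [- RInt F 0 s > 0] at [r = b], prevents the limit from being 0. *)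
Require Import Defs.
From Stdlib Require Import Reals Lra Lia Classical IndefiniteDescription.
From Coquelicot Require Import Coquelicot.
Open Scope R_scope.

(** * One-variable calculus *)

(** The obstacle is that [F] vanishes at 0 and [s] and is negative in between, so it is not monotone
    and the maximum principle cannot compare two solutions directly. Translation helps because the
    left-hand side in [t] has constant coefficients, while the weight grows: where [F <= 0],
    [U (t + a)] with [a >= 0] is a supersolution of the equation at [t], and a strict one if [a > 0]
    and its value lies in (0, s). The value [s] at both ends of the compact problem makes every
    solution with values in [0, s] a competitor, whatever its own boundary values; in particular a
    solution on a larger interval competes on every smaller one. Each passage to the limit may lose
    a boundary condition. When the left end recedes, an exponential barrier keeps the decay at -oo,
    and a uniform Lipschitz bound keeps the value [s] at a finite right end. When [b] grows, the
    decay at -oo is inherited from any approximation, and what must be excluded is collapse to 0;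
    this is why the energy bound has to be uniform in [b]. *)

Lemma is_derive_continuity_pt (f : R -> R) (x l : R) :
  is_derive f x l -> continuity_pt f x.
Proof.
  intros H. apply continuity_pt_filterlim.
  apply (ex_derive_continuous f x). now exists l.
Qed.

Lemma mean_value (f f1 : R -> R) (a b : R) :
  a < b -> (forall t, a <= t <= b -> is_derive f t (f1 t)) ->
  exists c, a < c < b /\ f b - f a = f1 c * (b - a).
Proof.
  intros Hab Hd.
  destruct (MVT_cor2 f f1 a b Hab) as [c [Hc1 Hc2]].
  { intros c Hc. apply is_derive_Reals. now apply Hd. }
  exists c. split; assumption.
Qed.

Lemma local_max_derivative (f : R -> R) (x l d : R) :
  0 < d -> is_derive f x l ->
  (forall t, Rabs (t - x) < d -> f t <= f x) -> l = 0.
Proof.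
  intros Hd Hf Hmax.
  pose (pr := exist (fun l => derivable_pt_abs f x l) l
                (proj1 (is_derive_Reals f x l) Hf)).
  change l with (derive_pt f x pr).
  apply deriv_maximum with (a := x - d) (b := x + d); try lra.
  intros t Ht1 Ht2. apply Hmax. apply Rabs_def1; lra.
Qed.

Lemma increasing_right_of_positive_derivative (f : R -> R) (x l : R) :
  is_derive f x l -> 0 < l ->
  exists d, 0 < d /\ forall t, x < t < x + d -> f x < f t.
Proof.
  intros Hf Hl. apply is_derive_Reals in Hf.
  destruct (Hf l Hl) as [d Hd]. exists d. split; [apply cond_pos|].
  intros t Ht. specialize (Hd (t - x) ltac:(lra) ltac:(apply Rabs_def1; lra)).
  replace (x + (t - x)) with t in Hd by ring.
  apply Rabs_def2 in Hd. destruct Hd as [_ Hd].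
  assert (Hq : 0 < (f t - f x) / (t - x)) by lra.
  assert (Hp := Rmult_lt_0_compat _ (t - x) Hq ltac:(lra)).
  replace ((f t - f x) / (t - x) * (t - x)) with (f t - f x) in Hp by (field; lra). lra.
Qed.

(** Since [f1] is differentiable at [x] only, the argument avoids Taylor's formula: if [l > 0], then
    [f1] is positive just to the right of [x] and the mean value theorem makes [f] exceed [f x]
    there. *)
Lemma second_derivative_at_max (f f1 : R -> R) (x l d : R) :
  0 < d -> (forall t, Rabs (t - x) < d -> is_derive f t (f1 t)) ->
  is_derive f1 x l ->
  (forall t, Rabs (t - x) < d -> f t <= f x) -> f1 x = 0 /\ l <= 0.
Proof.
  intros Hd Hf Hf1 Hmax.
  assert (H0 : f1 x = 0).
  { apply (local_max_derivative f x _ d Hd); [|assumption].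
    apply Hf. rewrite Rminus_diag, Rabs_R0. assumption. }
  split; [assumption|].
  apply Rnot_lt_le. intros Hl.
  destruct (increasing_right_of_positive_derivative f1 x l Hf1 Hl) as [e [He Hpos]].
  set (h := Rmin (e / 2) (d / 2)).
  assert (Hh : 0 < h /\ h < e /\ h < d).
  { assert (Hm1 := Rmin_l (e / 2) (d / 2)). assert (Hm2 := Rmin_r (e / 2) (d / 2)).
    assert (0 < h) by (apply Rmin_glb_lt; lra). unfold h in *; lra. }
  destruct (mean_value f f1 x (x + h)) as [c [Hc Hceq]]; [lra| |].
  { intros t Ht. apply Hf. apply Rabs_def1; lra. }
  assert (Hc1 := Hpos c ltac:(lra)).
  assert (f (x + h) <= f x) by (apply Hmax; apply Rabs_def1; lra).
  assert (0 < f1 c * (x + h - x)) by (apply Rmult_lt_0_compat; lra).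
  lra.
Qed.

Lemma second_derivative_at_min (f f1 : R -> R) (x l d : R) :
  0 < d -> (forall t, Rabs (t - x) < d -> is_derive f t (f1 t)) ->
  is_derive f1 x l ->
  (forall t, Rabs (t - x) < d -> f x <= f t) -> f1 x = 0 /\ 0 <= l.
Proof.
  intros Hd Hf Hf1 Hmin.
  destruct (second_derivative_at_max (fun t => - f t) (fun t => - f1 t) x (- l) d Hd)
    as [H1 H2].
  - intros t Ht. exact (is_derive_opp f t _ (Hf t Ht)).
  - exact (is_derive_opp f1 x l Hf1).
  - intros t Ht. specialize (Hmin t Ht). lra.
  - lra.
Qed.

(** The sign of [f2] is requested only at positive critical points, so in applications the
    first-order terms of the equation drop out, whatever the sign of [k]. *)
Lemma maximum_principle (f f1 f2 : R -> R) (a b : R) :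
  a <= b ->
  (forall t, a <= t <= b -> continuity_pt f t) ->
  (forall t, a < t < b -> is_derive f t (f1 t) /\ is_derive f1 t (f2 t)) ->
  f a <= 0 -> f b <= 0 ->
  (forall t, a < t < b -> 0 < f t -> f1 t = 0 -> 0 < f2 t) ->
  forall t, a <= t <= b -> f t <= 0.
Proof.
  intros Hab Hc Hd Ha Hb Hpos t Ht.
  destruct (continuity_ab_maj f a b Hab Hc) as [m [Hm Hmab]].
  apply Rle_trans with (f m); [now apply Hm|].
  apply Rnot_lt_le. intros Hfm.
  assert (Hin : a < m < b).
  { split; apply Rnot_le_lt; intros Hle.
    - replace m with a in Hfm by lra. lra.
    - replace m with b in Hfm by lra. lra. }
  assert (Hdist : 0 < Rmin (m - a) (b - m)) by (apply Rmin_glb_lt; lra).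
  assert (Hnear : forall r, Rabs (r - m) < Rmin (m - a) (b - m) -> a < r < b).
  { intros r Hr. apply Rabs_def2 in Hr.
    assert (H1 := Rmin_l (m - a) (b - m)). assert (H2 := Rmin_r (m - a) (b - m)). lra. }
  destruct (second_derivative_at_max f f1 m (f2 m) _ Hdist) as [H0 Hle].
  - intros r Hr. now apply Hd, Hnear.
  - now apply Hd.
  - intros r Hr. apply Hm. specialize (Hnear r Hr). lra.
  - specialize (Hpos m Hin Hfm H0). lra.
Qed.

Lemma lipschitz_of_derivative_bound (f f1 : R -> R) (a b C : R) :
  (forall t, a <= t <= b -> is_derive f t (f1 t)) ->
  (forall t, a <= t <= b -> Rabs (f1 t) <= C) ->
  forall x y, a <= x <= b -> a <= y <= b -> Rabs (f x - f y) <= C * Rabs (x - y).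
Proof.
  intros Hd HC.
  assert (H : forall x y, a <= x <= b -> a <= y <= b -> x < y ->
     Rabs (f x - f y) <= C * Rabs (x - y)).
  { intros x y Hx Hy Hxy.
    destruct (mean_value f f1 x y Hxy) as [c [Hc Heq]].
    { intros t Ht. apply Hd. lra. }
    rewrite Rabs_minus_sym, (Rabs_minus_sym x), Heq, Rabs_mult.
    apply Rmult_le_compat_r; [apply Rabs_pos|]. apply HC. lra. }
  intros x y Hx Hy. destruct (Rtotal_order x y) as [Hlt|[Heq|Hgt]].
  - now apply H.
  - rewrite Heq, !Rminus_diag, Rabs_R0. lra.
  - rewrite Rabs_minus_sym, (Rabs_minus_sym x). now apply H.
Qed.

(* Landau-type estimate: [f1] is at most [s / (y - x)] somewhere, and
   [exp (k t) f1] has derivative [exp (k t) h]. *)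
Lemma interior_derivative_bound (f f1 f2 : R -> R) (k s G x y : R) :
  x < y ->
  (forall t, x <= t <= y -> is_derive f t (f1 t) /\ is_derive f1 t (f2 t)) ->
  (forall t, x <= t <= y -> 0 <= f t <= s) ->
  (forall t, x <= t <= y -> Rabs (f2 t + k * f1 t) <= G) ->
  forall t, x <= t <= y ->
    Rabs (f1 t) <= exp (Rabs k * (y - x)) * (s / (y - x) + G * (y - x)).
Proof.
  intros Hxy Hd Hs HG t Ht.
  set (l := y - x).
  destruct (mean_value f f1 x y Hxy) as [c [Hc Hceq]].
  { intros r Hr. now apply Hd. }
  assert (Hfc : Rabs (f1 c) <= s / l).
  { assert (Hfc : f1 c = (f y - f x) / l) by (unfold l; rewrite Hceq; field; lra).
    rewrite Hfc. unfold Rdiv. rewrite Rabs_mult.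
    rewrite (Rabs_right (/ l)) by (apply Rle_ge, Rlt_le, Rinv_0_lt_compat; unfold l; lra).
    apply Rmult_le_compat_r; [apply Rlt_le, Rinv_0_lt_compat; unfold l; lra|].
    assert (H1 := Hs x ltac:(lra)). assert (H2 := Hs y ltac:(lra)).
    apply Rabs_le. lra. }
  assert (HG0 : 0 <= G) by (eapply Rle_trans; [apply Rabs_pos|apply (HG x); lra]).
  (* The exponential weight is based at [t]: it equals 1 at the point to be estimated. *)
  assert (Hexp : forall r, x <= r <= y -> exp (k * (r - t)) <= exp (Rabs k * l)).
  { intros r Hr.
    assert (k * (r - t) <= Rabs k * l).
    { apply Rle_trans with (Rabs (k * (r - t))); [apply Rle_abs|].
      rewrite Rabs_mult. apply Rmult_le_compat_l; [apply Rabs_pos|].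
      unfold l. apply Rabs_le. lra. }
    destruct (Rle_lt_or_eq_dec _ _ H) as [Hl|He]; [apply Rlt_le, exp_increasing, Hl|].
    rewrite He. lra. }
  assert (Hlip := lipschitz_of_derivative_bound
     (fun r => exp (k * (r - t)) * f1 r)
     (fun r => exp (k * (r - t)) * (f2 r + k * f1 r)) x y (exp (Rabs k * l) * G)).
  assert (Hct : Rabs (exp (k * (t - t)) * f1 t - exp (k * (c - t)) * f1 c) <=
     exp (Rabs k * l) * G * Rabs (t - c)).
  { apply Hlip; try lra.
    - intros r Hr. destruct (Hd r Hr) as [_ Hd2].
      assert (He : is_derive (fun r => exp (k * (r - t))) r (k * exp (k * (r - t))))
        by (auto_derive; [trivial|unfold Rminus; ring]).
      evar_last; [exact (is_derive_mult _ _ _ _ _ He Hd2 Rmult_comm)|].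
      unfold plus, mult; simpl. ring.
    - intros r Hr. rewrite Rabs_mult.
      rewrite (Rabs_right (exp _)) by (apply Rle_ge, Rlt_le, exp_pos).
      apply Rmult_le_compat; [apply Rlt_le, exp_pos|apply Rabs_pos|now apply Hexp|now apply HG]. }
  replace (k * (t - t)) with 0 in Hct by ring. rewrite exp_0, Rmult_1_l in Hct.
  assert (Hb : Rabs (exp (k * (c - t)) * f1 c) <= exp (Rabs k * l) * (s / l)).
  { rewrite Rabs_mult. rewrite (Rabs_right (exp _)) by (apply Rle_ge, Rlt_le, exp_pos).
    apply Rmult_le_compat; [apply Rlt_le, exp_pos|apply Rabs_pos|apply Hexp; lra|assumption]. }
  assert (Hd1 : Rabs (t - c) <= l) by (apply Rabs_le; unfold l; lra).
  assert (Hd2 : exp (Rabs k * l) * G * Rabs (t - c) <= exp (Rabs k * l) * G * l).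
  { apply Rmult_le_compat_l; [|assumption].
    apply Rmult_le_pos; [apply Rlt_le, exp_pos|assumption]. }
  assert (Htri := Rabs_triang (f1 t - exp (k * (c - t)) * f1 c) (exp (k * (c - t)) * f1 c)).
  replace (f1 t - exp (k * (c - t)) * f1 c + exp (k * (c - t)) * f1 c) with (f1 t) in Htri by ring.
  rewrite Rmult_plus_distr_l. lra.
Qed.

(** * The linear problem *)

Definition linear_ode (k m : R) (g V V1 : R -> R) (t : R) : Prop :=
  is_derive V t (V1 t) /\ is_derive V1 t (m * V t + g t - k * V1 t).

(** Adding the constant [e] to [W] lowers its source by [m * e], which pays for the discrepancy
    between the sources. With [e = 0] this is ordinary comparison; with [e > 0] it measures how
    solutions depend on the source. *)
Lemma linear_comparison (k m e : R) (g h V V1 W W1 : R -> R) (a b : R) :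
  0 < m -> a <= b ->
  (forall t, a <= t <= b -> linear_ode k m g V V1 t) ->
  (forall t, a <= t <= b -> linear_ode k m h W W1 t) ->
  (forall t, a <= t <= b -> h t <= g t + m * e) ->
  V a <= W a + e -> V b <= W b + e ->
  forall t, a <= t <= b -> V t <= W t + e.
Proof.
  intros Hm Hab HV HW Hgh Ha Hb t Ht.
  assert (Hd : forall t, a <= t <= b ->
    is_derive (fun t => V t - W t - e) t (V1 t - W1 t)).
  { intros r Hr. destruct (HV r Hr) as [HV1 _]. destruct (HW r Hr) as [HW1 _].
    assert (H := is_derive_minus _ _ _ _ _ (is_derive_minus _ _ _ _ _ HV1 HW1)
                   (is_derive_const e r)).
    evar_last; [exact H|]. unfold minus, plus, opp, zero; simpl. ring. }
  assert (H : V t - W t - e <= 0); [|lra].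
  apply (maximum_principle (fun t => V t - W t - e) (fun t => V1 t - W1 t)
     (fun t => (m * V t + g t - k * V1 t) - (m * W t + h t - k * W1 t)) a b Hab);
    try lra.
  - intros r Hr. exact (is_derive_continuity_pt _ _ _ (Hd r Hr)).
  - intros r Hr. split; [apply Hd; lra|].
    destruct (HV r ltac:(lra)) as [_ HV2]. destruct (HW r ltac:(lra)) as [_ HW2].
    exact (is_derive_minus _ _ _ _ _ HV2 HW2).
  - intros r Hr Hpos H0. specialize (Hgh r ltac:(lra)).
    replace (V1 r) with (W1 r) by lra.
    assert (0 < m * (V r - W r - e)) by (apply Rmult_lt_0_compat; assumption). lra.
Qed.

Lemma is_derive_RInt_continuous (f : R -> R) (a t : R) :
  (forall x, continuous f x) -> is_derive (fun t => RInt f a t) t (f t).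
Proof.
  intros Hf. apply (is_derive_RInt f (fun t => RInt f a t) a t); [|apply Hf].
  exists (mkposreal 1 Rlt_0_1). intros x _.
  apply (RInt_correct f), (ex_RInt_continuous f).
  intros; apply Hf.
Qed.

(* Variation of constants: [al] and [- be] are the roots of [x^2 + k x - m]. *)
Lemma linear_bvp (k m : R) (g : R -> R) (a b A B : R) :
  0 < m -> a < b -> (forall t, continuous g t) ->
  exists V V1 : R -> R,
    (forall t, linear_ode k m g V V1 t) /\ V a = A /\ V b = B.
Proof.
  intros Hm Hab Hg.
  set (D := sqrt (k ^ 2 + 4 * m)).
  assert (HD2 : D * D = k ^ 2 + 4 * m) by (apply sqrt_sqrt; nra).
  assert (HD0 : 0 <= D) by apply sqrt_pos.
  assert (HDk : Rabs k < D).
  { apply Rsqr_incrst_0; [|apply Rabs_pos|assumption]. rewrite <- Rsqr_abs. unfold Rsqr. nra. }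
  apply Rabs_def2 in HDk.
  set (al := (D - k) / 2). set (be := (D + k) / 2).
  assert (Hal : 0 < al) by (unfold al; lra).
  assert (Hbe : 0 < be) by (unfold be; lra).
  assert (Hprod : m = al * be) by (unfold al, be; nra).
  assert (Hk : k = be - al) by (unfold al, be; lra).
  clearbody al be. clear D HD2 HD0 HDk. subst m k.
  set (I1 := fun t => RInt (fun x => exp (- al * x) * g x) a t).
  set (I2 := fun t => RInt (fun x => exp (be * x) * g x) a t).
  assert (HI1 : forall t, is_derive I1 t (exp (- al * t) * g t)).
  { intros t. apply (is_derive_RInt_continuous (fun x => exp (- al * x) * g x)).
    intros x. apply (continuous_mult (fun x => exp (- al * x)) g); [|apply Hg].
    apply (ex_derive_continuous (fun x => exp (- al * x))). auto_derive; trivial. }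
  assert (HI2 : forall t, is_derive I2 t (exp (be * t) * g t)).
  { intros t. apply (is_derive_RInt_continuous (fun x => exp (be * x) * g x)).
    intros x. apply (continuous_mult (fun x => exp (be * x)) g); [|apply Hg].
    apply (ex_derive_continuous (fun x => exp (be * x))). auto_derive; trivial. }
  set (P := fun t => (exp (al * t) * I1 t - exp (- be * t) * I2 t) / (al + be)).
  (* [P] vanishes at [a] because both integrals start there, so the coefficients [c] and [A - c]
     give the value [A] at [a]; this [c] fits [B] at [b]. *)
  set (c := (B - P b - A * exp (- be * (b - a))) / (exp (al * (b - a)) - exp (- be * (b - a)))).
  assert (HE1 : forall t, exp (al * t) * (exp (- al * t) * g t) = g t).
  { intros t. rewrite <- Rmult_assoc, <- exp_plus.
    replace (al * t + - al * t) with 0 by ring. rewrite exp_0. ring. }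
  assert (HE2 : forall t, exp (- be * t) * (exp (be * t) * g t) = g t).
  { intros t. rewrite <- Rmult_assoc, <- exp_plus.
    replace (- be * t + be * t) with 0 by ring. rewrite exp_0. ring. }
  assert (HXl : forall c t, is_derive (fun t => exp (c * t)) t (c * exp (c * t))).
  { intros c0 t. auto_derive; [trivial|ring]. }
  exists (fun t => c * exp (al * (t - a)) + (A - c) * exp (- be * (t - a)) + P t).
  exists (fun t => c * al * exp (al * (t - a)) - (A - c) * be * exp (- be * (t - a)) +
     (al * (exp (al * t) * I1 t) + be * (exp (- be * t) * I2 t)) / (al + be)).
  assert (HP1 : forall t, is_derive (fun t => exp (al * t) * I1 t) t
     (al * (exp (al * t) * I1 t) + g t)).
  { intros t. evar_last; [exact (is_derive_mult _ _ _ _ _ (HXl al t) (HI1 t) Rmult_comm)|].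
    unfold plus, mult; simpl. rewrite HE1. ring. }
  assert (HP2 : forall t, is_derive (fun t => exp (- be * t) * I2 t) t
     (- be * (exp (- be * t) * I2 t) + g t)).
  { intros t. evar_last; [exact (is_derive_mult _ _ _ _ _ (HXl (- be) t) (HI2 t) Rmult_comm)|].
    unfold plus, mult; simpl. rewrite HE2. ring. }
  set (Q1 := fun t => exp (al * t) * I1 t) in *.
  set (Q2 := fun t => exp (- be * t) * I2 t) in *.
  assert (Hne : al + be <> 0) by lra.
  assert (HP : forall t, is_derive P t ((al * Q1 t + be * Q2 t) / (al + be))).
  { intros t. unfold P. apply is_derive_ext with (fun t => / (al + be) * (Q1 t - Q2 t)).
    - intros x. simpl. unfold Q1, Q2. field. assumption.
    - evar_last; [exact (is_derive_scal _ _ (/ (al + be)) _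
        (is_derive_minus _ _ _ _ _ (HP1 t) (HP2 t)))|].
      unfold minus, plus, opp, Q1, Q2; simpl. field. assumption. }
  assert (HP' : forall t, is_derive (fun t => (al * Q1 t + be * Q2 t) / (al + be)) t
     ((al * al * Q1 t - be * be * Q2 t) / (al + be) + g t)).
  { intros t. apply is_derive_ext with (fun t => / (al + be) * (al * Q1 t + be * Q2 t)).
    - intros x. simpl. field. assumption.
    - evar_last; [exact (is_derive_scal _ _ (/ (al + be)) _
        (is_derive_plus _ _ _ _ _ (is_derive_scal _ _ al _ (HP1 t))
           (is_derive_scal _ _ be _ (HP2 t))))|].
      unfold plus, Q1, Q2; simpl. field. assumption. }
  assert (HH : forall c d t, is_derive (fun t => c * exp (al * (t - a)) + d * exp (- be * (t - a))) t
     (c * al * exp (al * (t - a)) - d * be * exp (- be * (t - a)))).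
  { intros c0 d0 t. auto_derive; [trivial|]. unfold Rminus. ring. }
  split; [|split].
  - intros t. split.
    + exact (is_derive_plus _ _ _ _ _ (HH c (A - c) t) (HP t)).
    + evar_last.
      * refine (is_derive_plus _ _ _ _ _ _ (HP' t)).
        apply is_derive_ext with (fun t => c * al * exp (al * (t - a)) + (- (A - c) * be) * exp (- be * (t - a))).
        { intros x. simpl. ring. }
        apply HH.
      * unfold plus; simpl. unfold P, Q1, Q2. field. assumption.
  - unfold P, I1, I2. rewrite !RInt_point. unfold zero; simpl.
    replace (a - a) with 0 by ring. rewrite !Rmult_0_r, exp_0. field. assumption.
  - assert (exp (- be * (b - a)) < exp (al * (b - a))) by (apply exp_increasing; nra).
    unfold c. field. lra.
Qed.

(** Composition with [clamp a b] extends a function from [a, b] to the line by constants and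
    preserves its Lipschitz constant. It supplies the globally continuous sources that [linear_bvp]
    expects. *)
Definition clamp (a b t : R) : R := Rmax a (Rmin b t).

Lemma clamp_id (a b t : R) : a <= t <= b -> clamp a b t = t.
Proof. intros H. unfold clamp. rewrite Rmin_right, Rmax_right; lra. Qed.

Lemma clamp_in (a b t : R) : a <= b -> a <= clamp a b t <= b.
Proof.
  intros H. unfold clamp. split; [apply Rmax_l|]. apply Rmax_lub; [assumption|apply Rmin_l].
Qed.

Lemma clamp_lipschitz (a b x y : R) : Rabs (clamp a b x - clamp a b y) <= Rabs (x - y).
Proof.
  unfold clamp, Rmax, Rmin.
  repeat (destruct Rle_dec); apply Rabs_le; unfold Rabs; destruct Rcase_abs; lra.
Qed.

Lemma lipschitz_continuous (f : R -> R) (C : R) :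
  (forall x y, Rabs (f x - f y) <= C * Rabs (x - y)) -> forall t, continuous f t.
Proof.
  intros H t. apply continuity_pt_filterlim.
  assert (HC : 0 <= C).
  { specialize (H 1 0). rewrite Rminus_0_r, Rabs_R1, Rmult_1_r in H.
    eapply Rle_trans; [apply Rabs_pos|exact H]. }
  intros e He. exists (e / (C + 1)). split; [apply Rdiv_lt_0_compat; lra|].
  intros x [_ Hx]. simpl in *. unfold R_dist in *.
  apply Rle_lt_trans with (C * Rabs (x - t)); [apply H|].
  apply Rle_lt_trans with (C * (e / (C + 1))).
  - apply Rmult_le_compat_l; [assumption|lra].
  - replace e with ((C + 1) * (e / (C + 1))) at 2 by (field; lra).
    apply Rmult_lt_compat_r; [apply Rdiv_lt_0_compat|]; lra.
Qed.

Lemma lipschitz_clamp (f : R -> R) (a b C : R) :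
  a <= b -> 0 <= C ->
  (forall x y, a <= x <= b -> a <= y <= b -> Rabs (f x - f y) <= C * Rabs (x - y)) ->
  forall x y, Rabs (f (clamp a b x) - f (clamp a b y)) <= C * Rabs (x - y).
Proof.
  intros Hab HC H x y.
  eapply Rle_trans; [apply H; now apply clamp_in|].
  apply Rmult_le_compat_l; [assumption|apply clamp_lipschitz].
Qed.

(** * The Dirichlet problem on a compact interval *)

(** The supremum is taken at each point separately; [U0] and [s] keep it finite. Whether it belongs
    to [S] again is left to the application. *)
Lemma pointwise_sup (S : (R -> R) -> Prop) (U0 : R -> R) (s : R) :
  S U0 -> (forall U t, S U -> U t <= s) ->
  exists f : R -> R, (forall U t, S U -> U t <= f t) /\
    (forall t c, (forall U, S U -> U t <= c) -> f t <= c).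
Proof.
  intros H0 Hs.
  set (E := fun t y => exists U, S U /\ y = U t).
  exists (fun t => real (Lub_Rbar (E t))).
  assert (HL : forall t, is_lub (E t) (real (Lub_Rbar (E t)))).
  { intros t. destruct (Lub_Rbar_correct (E t)) as [Hub Hlub].
    assert (H1 : Rbar_le (U0 t) (Lub_Rbar (E t))) by (apply Hub; now exists U0).
    assert (H2 : Rbar_le (Lub_Rbar (E t)) s).
    { apply Hlub. intros y [U [HU ->]]. now apply Hs. }
    destruct (Lub_Rbar (E t)) as [l| |]; simpl in *; try tauto.
    split; [exact Hub|]. intros c Hc. exact (Hlub c Hc). }
  split.
  - intros U t HU. apply HL. now exists U.
  - intros t c Hc. apply HL. intros y [U [HU ->]]. now apply Hc.
Qed.

(** This is what the comparison arguments retain of a C1 nonlinearity: a Lipschitz constant on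
    [0, s], and monotonicity just below [s], which stands for the positive derivative there. *)
Record bistable (q s K : R) (F : R -> R) : Prop := {
  bistable_q : 0 < q;
  bistable_s : 0 < s;
  bistable_K : 0 < K;
  bistable_continuous : forall t, continuous F t;
  bistable_zero : F 0 = 0;
  bistable_one : F s = 0;
  bistable_neg : forall t, 0 < t < s -> F t < 0;
  bistable_nonneg : forall t, s < t -> 0 <= F t;
  bistable_lipschitz : forall u v, 0 <= u <= s -> 0 <= v <= s ->
    Rabs (F u - F v) <= K * Rabs (u - v);
  bistable_stable : exists d, 0 < d < s /\
    forall u v, s - d <= u -> u <= v -> v <= s -> F u <= F v
}.

Lemma bistable_le_0 {q s K : R} {F : R -> R} (H : bistable q s K F) (u : R) :
  0 <= u <= s -> F u <= 0.
Proof.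
  intros [H0 H1].
  destruct H0 as [H0| <-]; [|rewrite (bistable_zero _ _ _ _ H); lra].
  destruct H1 as [H1| ->]; [|rewrite (bistable_one _ _ _ _ H); lra].
  apply Rlt_le, (bistable_neg _ _ _ _ H). lra.
Qed.

Lemma bistable_lower {q s K : R} {F : R -> R} (H : bistable q s K F) (u : R) :
  0 <= u <= s -> - (K * u) <= F u.
Proof.
  intros Hu.
  assert (Hl := bistable_lipschitz _ _ _ _ H u 0 Hu
    ltac:(assert (Hs := bistable_s _ _ _ _ H); lra)).
  rewrite (bistable_zero _ _ _ _ H), !Rminus_0_r, (Rabs_right u) in Hl by lra.
  assert (Hn := Rle_abs (- F u)). rewrite Rabs_Ropp in Hn. lra.
Qed.

(* The equation in the variable [t = ln r], with [k = p - 1]. *)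
Definition log_ode (k q : R) (F U U1 : R -> R) (t : R) : Prop :=
  linear_ode k q (fun t => exp (2 * t) * F (U t)) U U1 t.

Lemma exp_le (x y : R) : x <= y -> exp x <= exp y.
Proof.
  intros [H| ->]; [apply Rlt_le, exp_increasing, H|lra].
Qed.

(** For values in [0, s], [q * U] and the weighted nonlinearity are bounded independently of [U].
    The resulting estimate is therefore common to all solutions on an interval, and provides the
    equicontinuity of every sequence below. *)
Lemma log_ode_derivative_bound {q s K : R} {F : R -> R} (H : bistable q s K F)
  (k : R) (U U1 : R -> R) (x y : R) :
  x < y ->
  (forall t, x <= t <= y -> log_ode k q F U U1 t /\ 0 <= U t <= s) ->
  forall t, x <= t <= y -> Rabs (U1 t) <=
    exp (Rabs k * (y - x)) * (s / (y - x) + (q + K * exp (2 * y)) * s * (y - x)).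
Proof.
  intros Hxy HU t Ht.
  apply (interior_derivative_bound U U1
    (fun t => q * U t + exp (2 * t) * F (U t) - k * U1 t) k s); trivial.
  - intros r Hr. apply HU; assumption.
  - intros r Hr. apply HU; assumption.
  - intros r Hr. destruct (HU r Hr) as [_ Hr0].
    assert (H1 := bistable_le_0 H _ Hr0). assert (H2 := bistable_lower H _ Hr0).
    assert (Hq := bistable_q _ _ _ _ H). assert (HK := bistable_K _ _ _ _ H).
    assert (He := exp_le (2 * r) (2 * y) ltac:(lra)). assert (Hp := exp_pos (2 * r)).
    replace (q * U r + exp (2 * r) * F (U r) - k * U1 r + k * U1 r)
      with (q * U r + exp (2 * r) * F (U r)) by ring.
    assert (0 <= q * U r <= q * s) by (split; [apply Rmult_le_pos|apply Rmult_le_compat_l]; lra).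
    assert (HKs : K * U r <= K * s) by (apply Rmult_le_compat_l; lra).
    assert (0 <= exp (2 * r) * - F (U r) <= exp (2 * y) * (K * s)).
    { split; [apply Rmult_le_pos; lra|]. apply Rmult_le_compat; lra. }
    apply Rabs_le. lra.
Qed.

(* The operator sending [U] to the solution [V] of the linear problem with
   right-hand side [h U] is monotone because [u |-> exp (2 t) F u - M u] is
   nonincreasing on [0, s] for [t <= b]; the solution is the Knaster-Tarski
   greatest fixed point in the complete lattice of [C]-Lipschitz functions. *)
Lemma dirichlet_maximal_solution {q s K : R} {F : R -> R} (H : bistable q s K F)
  (k a b : R) :
  a < b ->
  exists V V1 : R -> R,
    (forall t, a <= t <= b -> log_ode k q F V V1 t /\ 0 <= V t <= s) /\
    V a = s /\ V b = s /\
    (forall W W1 : R -> R,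
       (forall t, a <= t <= b -> log_ode k q F W W1 t /\ 0 <= W t <= s) ->
       forall t, a <= t <= b -> W t <= V t).
Proof.
  intros Hab.
  assert (Hq := bistable_q _ _ _ _ H). assert (HK := bistable_K _ _ _ _ H).
  assert (Hs := bistable_s _ _ _ _ H).
  set (M := K * exp (2 * b)).
  assert (HM : 0 < M) by (apply Rmult_lt_0_compat; [assumption|apply exp_pos]).
  set (h := fun (U : R -> R) t => exp (2 * t) * F (U t) - M * U t).
  set (G := (q + 3 * M) * s).
  (* [C] is the derivative bound obtained from [G] by [interior_derivative_bound]. With this
     constant the operator maps the lattice into itself, and every competing solution belongs to
     it. *)
  set (C := exp (Rabs k * (b - a)) * (s / (b - a) + G * (b - a))).
  assert (HG : 0 < G) by (apply Rmult_lt_0_compat; lra).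
  assert (HC : 0 <= C).
  { apply Rmult_le_pos; [apply Rlt_le, exp_pos|].
    apply Rplus_le_le_0_compat; [apply Rlt_le, Rdiv_lt_0_compat; lra|].
    apply Rmult_le_pos; lra. }
  assert (Hexp : forall t, a <= t <= b -> 0 < exp (2 * t) /\ exp (2 * t) * K <= M).
  { intros t Ht. split; [apply exp_pos|]. unfold M. rewrite Rmult_comm.
    apply Rmult_le_compat_l; [lra|]. apply exp_le. lra. }
  assert (Hmono : forall U V t, a <= t <= b -> 0 <= U t -> U t <= V t -> V t <= s ->
     h V t <= h U t).
  { intros U V t Ht HU HUV HV. unfold h. destruct (Hexp t Ht) as [He1 He2].
    assert (HL := bistable_lipschitz _ _ _ _ H (V t) (U t) ltac:(lra) ltac:(lra)).
    rewrite (Rabs_right (V t - U t)) in HL by lra.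
    assert (HF : F (V t) - F (U t) <= K * (V t - U t)) by (eapply Rle_trans; [apply Rle_abs|exact HL]).
    assert (exp (2 * t) * (F (V t) - F (U t)) <= exp (2 * t) * (K * (V t - U t)))
      by (apply Rmult_le_compat_l; lra).
    assert (exp (2 * t) * K * (V t - U t) <= M * (V t - U t))
      by (apply Rmult_le_compat_r; lra).
    lra. }
  assert (Hh0 : forall t, h (fun _ => 0) t = 0).
  { intros t. unfold h. rewrite (bistable_zero _ _ _ _ H). ring. }
  assert (Hhs : forall t, h (fun _ => s) t = - M * s).
  { intros t. unfold h. rewrite (bistable_one _ _ _ _ H). ring. }
  set (X := fun U : R -> R => (forall t, 0 <= U t <= s) /\
     (forall x y, Rabs (U x - U y) <= C * Rabs (x - y))).
  (* A relation rather than a function, since [linear_bvp] only asserts existence; [Hcomp] below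
     shows that [V] is determined on [a, b]. *)
  set (step := fun U V V1 => (forall t, linear_ode k (q + M) (h U) V V1 t) /\ V a = s /\ V b = s).
  assert (Hexists : forall U, X U -> exists V V1, step U V V1).
  { intros U [_ HU2]. apply linear_bvp; [lra|assumption|].
    assert (HUc := lipschitz_continuous U C HU2).
    intros t. unfold h. apply (continuous_minus (fun t => exp (2 * t) * F (U t)) (fun t => M * U t)).
    - apply (continuous_mult (fun t => exp (2 * t)) (fun t => F (U t))).
      + apply (ex_derive_continuous (fun t => exp (2 * t))). auto_derive; trivial.
      + apply (continuous_comp U F); [apply HUc|apply (bistable_continuous _ _ _ _ H)].
    - apply (continuous_mult (fun _ => M) U); [apply continuous_const|apply HUc]. }
  assert (Hcomp : forall U W V V1 Z Z1, step U V V1 -> step W Z Z1 ->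
     (forall t, a <= t <= b -> 0 <= U t) -> (forall t, a <= t <= b -> W t <= s) ->
     (forall t, a <= t <= b -> U t <= W t) -> forall t, a <= t <= b -> V t <= Z t).
  { intros U W V V1 Z Z1 [HV [HVa HVb]] [HZ [HZa HZb]] HU0 HWs HUW t Ht.
    assert (V t <= Z t + 0); [|lra].
    apply (linear_comparison k (q + M) 0 (h U) (h W) V V1 Z Z1 a b); try lra.
    - intros; apply HV.
    - intros; apply HZ.
    - intros r Hr. rewrite Rmult_0_r, Rplus_0_r. apply Hmono; auto. }
  assert (Hrange : forall U V V1, X U -> step U V V1 -> forall t, a <= t <= b -> 0 <= V t <= s).
  { intros U V V1 [HU _] [HV [HVa HVb]] t Ht.
    (* A constant [c] solves the linear problem with source [- (q + M) * c]. Comparison with [c = 0]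
       and [c = s] traps [V] in [0, s]. *)
    assert (Hconst : forall c t, linear_ode k (q + M) (fun _ => - (q + M) * c) (fun _ => c) (fun _ => 0) t).
    { intros c r. split; [exact (is_derive_const c r)|].
      evar_last; [exact (is_derive_const 0 r)|]. unfold zero; simpl. ring. }
    split.
    - assert (0 <= V t + 0); [|lra].
      apply (linear_comparison k (q + M) 0 (fun _ => - (q + M) * 0) (h U) (fun _ => 0) (fun _ => 0) V V1 a b); try lra.
      + intros; apply Hconst.
      + intros; apply HV.
      + intros r Hr. assert (Hm := Hmono (fun _ => 0) U r Hr).
        rewrite Hh0 in Hm. specialize (HU r). lra.
    - assert (V t <= s + 0); [|lra].
      apply (linear_comparison k (q + M) 0 (h U) (fun _ => - (q + M) * s) V V1 (fun _ => s) (fun _ => 0) a b); try lra.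
      + intros; apply HV.
      + intros; apply Hconst.
      + intros r Hr. assert (Hm := Hmono U (fun _ => s) r Hr).
        rewrite Hhs in Hm. specialize (HU r).
        assert (0 <= q * s) by (apply Rmult_le_pos; lra). lra. }
  assert (Hclamp : forall V V1 V2,
     (forall t, a <= t <= b -> is_derive V t (V1 t) /\ is_derive V1 t (V2 t)) ->
     (forall t, a <= t <= b -> 0 <= V t <= s) ->
     (forall t, a <= t <= b -> Rabs (V2 t + k * V1 t) <= G) ->
     X (fun t => V (clamp a b t))).
  { intros V V1 V2 HV HVs HV2. split.
    - intros t. apply HVs, clamp_in. lra.
    - apply (lipschitz_clamp V a b C); [lra|assumption|].
      apply (lipschitz_of_derivative_bound V V1 a b C).
      + intros; now apply HV.
      + exact (interior_derivative_bound V V1 V2 k s G a b Hab HV HVs HV2). }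
  assert (HFb : forall t u, a <= t <= b -> 0 <= u <= s -> - (M * s) <= exp (2 * t) * F u <= 0).
  { intros t u Ht Hu. destruct (Hexp t Ht) as [He1 He2].
    assert (H1 := bistable_le_0 H u Hu). assert (H2 := bistable_lower H u Hu).
    assert (0 <= exp (2 * t) * - F u) by (apply Rmult_le_pos; lra).
    assert (exp (2 * t) * - F u <= exp (2 * t) * (K * u)) by (apply Rmult_le_compat_l; lra).
    assert (exp (2 * t) * K * u <= M * s) by (apply Rmult_le_compat; nra).
    lra. }
  assert (Hstep : forall U V V1, X U -> step U V V1 -> X (fun t => V (clamp a b t))).
  { intros U V V1 HU HV. assert (HVs := Hrange U V V1 HU HV).
    apply (Hclamp V V1 (fun t => (q + M) * V t + h U t - k * V1 t)); [|assumption|].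
    - intros t _. apply (proj1 HV t).
    - intros t Ht. replace ((q + M) * V t + h U t - k * V1 t + k * V1 t) with ((q + M) * V t + h U t) by ring.
      destruct HU as [HU _]. specialize (HU t). specialize (HVs t Ht).
      assert (HF := HFb t (U t) Ht HU).
      assert (0 <= (q + M) * V t <= (q + M) * s) by (split; [apply Rmult_le_pos|apply Rmult_le_compat_l]; lra).
      assert (0 <= M * U t <= M * s) by (split; [apply Rmult_le_pos|apply Rmult_le_compat_l]; lra).
      assert (0 < q * s) by (apply Rmult_lt_0_compat; lra).
      unfold h, G. apply Rabs_le. lra. }
  set (S := fun U => X U /\ forall V V1, step U V V1 -> forall t, a <= t <= b -> U t <= V t).
  assert (HS0 : S (fun _ => 0)).
  { assert (HX0 : X (fun _ => 0)).
    { split; [intros; lra|]. intros x y. rewrite Rminus_diag, Rabs_R0.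
      apply Rmult_le_pos; [assumption|apply Rabs_pos]. }
    split; [assumption|]. intros V V1 HV t Ht. now apply (Hrange (fun _ => 0) V V1). }
  destruct (pointwise_sup S (fun _ => 0) s HS0) as [Us [HUs1 HUs2]].
  { intros U t [[HU _] _]. apply HU. }
  (* A pointwise supremum of [C]-Lipschitz functions is [C]-Lipschitz, so the source built from [Us]
     is continuous and the operator applies to it. *)
  assert (HXs : X Us).
  { split.
    - intros t. split; [exact (HUs1 (fun _ => 0) t HS0)|].
      apply HUs2. intros U [[HU _] _]. apply HU.
    - assert (Hone : forall x y, Us x - Us y <= C * Rabs (x - y)).
      { intros x y. assert (Us x <= Us y + C * Rabs (x - y)); [|lra].
        apply HUs2. intros U HU. assert (Hy := HUs1 U y HU).
        assert (HL := proj2 (proj1 HU) x y). assert (Ha := Rle_abs (U x - U y)). lra. }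
      intros x y. assert (H1 := Hone x y). assert (H2 := Hone y x).
      rewrite (Rabs_minus_sym y x) in H2. apply Rabs_le. lra. }
  destruct (Hexists Us HXs) as [V [V1 HV]].
  assert (HVr := Hrange Us V V1 HXs HV).
  assert (HXV := Hstep Us V V1 HXs HV).
  assert (HUV : forall t, a <= t <= b -> Us t <= V t).
  { intros t Ht. apply HUs2. intros U [HU1 HU2].
    destruct (Hexists U HU1) as [Z [Z1 HZ]].
    apply Rle_trans with (Z t); [now apply (HU2 Z Z1)|].
    apply (Hcomp U Us Z Z1 V V1); trivial.
    - intros; apply HU1.
    - intros; apply HXs.
    - intros r _. apply HUs1. now split. }
  assert (HSV : S (fun t => V (clamp a b t))).
  { split; [assumption|]. intros Z Z1 HZ t Ht. rewrite clamp_id by assumption.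
    apply (Hcomp Us (fun t => V (clamp a b t)) V V1 Z Z1); trivial.
    - intros; apply HXs.
    - intros; apply HXV.
    - intros r Hr. rewrite clamp_id by assumption. now apply HUV. }
  assert (Heq : forall t, a <= t <= b -> Us t = V t).
  { intros t Ht. apply Rle_antisym; [now apply HUV|].
    assert (Hle := HUs1 _ t HSV). simpl in Hle. now rewrite clamp_id in Hle. }
  destruct HV as [HV [HVa HVb]].
  exists V, V1. split; [|split; [assumption|split; [assumption|]]].
  - intros t Ht. split; [|now apply HVr].
    destruct (HV t) as [HV1 HV2]. split; [assumption|].
    evar_last; [exact HV2|]. unfold h. rewrite Heq by assumption. ring.
  (* A solution [W] solves the linear problem with its own source and is at most [s] at both ends,
     so it lies below its image under the operator and hence below [Us]. *)
  - intros W W1 HW t Ht. rewrite <- Heq by assumption.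
    rewrite <- (clamp_id a b t) at 1 by assumption.
    apply (HUs1 (fun t => W (clamp a b t))). split.
    + apply (Hclamp W W1 (fun t => q * W t + exp (2 * t) * F (W t) - k * W1 t)).
      * intros r Hr. apply (HW r Hr).
      * intros r Hr. apply (HW r Hr).
      * intros r Hr. destruct (HW r Hr) as [_ HWr]. assert (HF := HFb r (W r) Hr HWr).
        replace (q * W r + exp (2 * r) * F (W r) - k * W1 r + k * W1 r)
          with (q * W r + exp (2 * r) * F (W r)) by ring.
        assert (0 <= q * W r <= q * s) by (split; [apply Rmult_le_pos|apply Rmult_le_compat_l]; lra).
        assert (0 < M * s) by (apply Rmult_lt_0_compat; lra).
        unfold G. apply Rabs_le. lra.
    + intros Z Z1 [HZ [HZa HZb]] r Hr. rewrite clamp_id by assumption.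
      assert (W r <= Z r + 0); [|lra].
      apply (linear_comparison k (q + M) 0 (h W) (h (fun t => W (clamp a b t))) W W1 Z Z1 a b); try lra.
      * intros x Hx. destruct (HW x Hx) as [[HW1 HW2] _]. split; [assumption|].
        evar_last; [exact HW2|]. unfold h. ring.
      * intros; apply HZ.
      * intros x Hx. unfold h. rewrite clamp_id by assumption. lra.
      * rewrite HZa. assert (HWa := proj2 (HW a ltac:(lra))). lra.
      * rewrite HZb. assert (HWb := proj2 (HW b ltac:(lra))). lra.
Qed.

(** * Limits of decreasing sequences of solutions *)

Lemma is_lim_seq_le_const (u : nat -> R) (l c : R) :
  is_lim_seq u l -> (forall n, u n <= c) -> l <= c.
Proof.
  intros Hu Hc. exact (is_lim_seq_le u (fun _ => c) l c Hc Hu (is_lim_seq_const c)).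
Qed.

Lemma is_lim_seq_const_le (u : nat -> R) (l c : R) :
  is_lim_seq u l -> (forall n, c <= u n) -> c <= l.
Proof.
  intros Hu Hc. exact (is_lim_seq_le (fun _ => c) u c l Hc (is_lim_seq_const c) Hu).
Qed.

Lemma decreasing_seq_le (u : nat -> R) :
  (forall n, u (S n) <= u n) -> forall n m, (n <= m)%nat -> u m <= u n.
Proof.
  intros Hu n m Hnm. induction Hnm as [|m _ IH]; [lra|]. specialize (Hu m). lra.
Qed.

Lemma lipschitz_limit (f : nat -> R -> R) (g : R -> R) (a b C : R) :
  (forall n x y, a <= x <= b -> a <= y <= b -> Rabs (f n x - f n y) <= C * Rabs (x - y)) ->
  (forall x, a <= x <= b -> is_lim_seq (fun n => f n x) (g x)) ->
  forall x y, a <= x <= b -> a <= y <= b -> Rabs (g x - g y) <= C * Rabs (x - y).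
Proof.
  intros Hf Hg x y Hx Hy.
  apply (is_lim_seq_le_const (fun n => Rabs (f n x - f n y))); [|intros; now apply Hf].
  apply (is_lim_seq_abs _ (g x - g y)). apply is_lim_seq_minus'; now apply Hg.
Qed.

(** A form of Dini's theorem by an [e / 3] argument: monotonicity lets one index serve all nodes of
    a finite net of mesh [d], and the common Lipschitz constant covers the gaps for [f n] and for
    [g]. *)
Lemma uniform_of_lipschitz_decreasing (f : nat -> R -> R) (g : R -> R) (a b C e : R) :
  a < b -> 0 < e ->
  (forall n x y, a <= x <= b -> a <= y <= b -> Rabs (f n x - f n y) <= C * Rabs (x - y)) ->
  (forall n x, a <= x <= b -> f (S n) x <= f n x) ->
  (forall x, a <= x <= b -> is_lim_seq (fun n => f n x) (g x)) ->
  exists n, forall x, a <= x <= b -> f n x <= g x + e.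
Proof.
  intros Hab He Hf Hdec Hlim.
  assert (Hg := lipschitz_limit f g a b C Hf Hlim).
  assert (HC : 0 <= C).
  { specialize (Hg a b ltac:(lra) ltac:(lra)).
    assert (H0 := Rabs_pos (g a - g b)).
    assert (H1 : 0 < Rabs (a - b)) by (apply Rabs_pos_lt; lra).
    apply Rnot_lt_le. intros HC. nra. }
  set (d := e / (3 * (C + 1))).
  assert (Hd : 0 < d) by (apply Rdiv_lt_0_compat; lra).
  assert (HCd : C * d <= e / 3).
  { assert (e / 3 = (C + 1) * d) by (unfold d; field; lra). nra. }
  assert (Hnet : forall m, exists n, forall i, (i <= m)%nat -> a + INR i * d <= b ->
     f n (a + INR i * d) <= g (a + INR i * d) + e / 3).
  { assert (Hpt : forall x, a <= x <= b -> exists n, f n x <= g x + e / 3).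
    { intros x Hx. assert (Hl := Hlim x Hx). apply is_lim_seq_spec in Hl.
      destruct (Hl (mkposreal (e / 3) ltac:(lra))) as [n Hn].
      specialize (Hn n (Nat.le_refl n)). simpl in Hn. apply Rabs_def2 in Hn.
      exists n. lra. }
    assert (Hle : forall i, a <= a + INR i * d).
    { intros i. assert (0 <= INR i * d) by (apply Rmult_le_pos; [apply pos_INR|lra]). lra. }
    induction m as [|m [n Hn]].
    - destruct (Hpt a ltac:(lra)) as [n Hn]. exists n. intros i Hi _.
      replace i with 0%nat by lia. simpl. now rewrite Rmult_0_l, Rplus_0_r.
    - destruct (Rle_dec (a + INR (S m) * d) b) as [Hb|Hb].
      + destruct (Hpt (a + INR (S m) * d)) as [n' Hn']; [split; [apply Hle|exact Hb]|].
        exists (Nat.max n n'). intros i Hi Hib.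
        assert (Hx : a <= a + INR i * d <= b) by (split; [apply Hle|exact Hib]).
        assert (Hmon := decreasing_seq_le (fun n => f n (a + INR i * d))
                          (fun n => Hdec n _ Hx)).
        destruct (Nat.eq_dec i (S m)) as [->|Hne].
        * eapply Rle_trans; [apply (Hmon n' (Nat.max n n')); lia|exact Hn'].
        * eapply Rle_trans; [apply (Hmon n (Nat.max n n')); lia|apply Hn; [lia|exact Hib]].
      + exists n. intros i Hi Hib. apply Hn; [|exact Hib].
        destruct (Nat.eq_dec i (S m)) as [->|Hne]; [contradiction|lia]. }
  destruct (nfloor_ex ((b - a) / d)) as [m Hm]; [apply Rlt_le, Rdiv_lt_0_compat; lra|].
  destruct (Hnet m) as [n Hn]. exists n. intros x Hx.
  destruct (nfloor_ex ((x - a) / d)) as [i Hi].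
  { apply Rmult_le_pos; [lra|apply Rlt_le, Rinv_0_lt_compat, Hd]. }
  assert (Hxd : (x - a) / d * d = x - a) by (field; lra).
  assert (Hbd : (b - a) / d * d = b - a) by (field; lra).
  assert (Hi1 : INR i * d <= x - a) by (rewrite <- Hxd; apply Rmult_le_compat_r; lra).
  assert (Hi2 : x - a <= (INR i + 1) * d) by (rewrite <- Hxd; apply Rmult_le_compat_r; lra).
  assert (Hi0 : 0 <= INR i * d) by (apply Rmult_le_pos; [apply pos_INR|lra]).
  assert (Him : (i <= m)%nat).
  { assert (INR i < INR (S m)); [|apply Nat.lt_succ_r, INR_lt; assumption].
    rewrite S_INR. apply Rle_lt_trans with ((b - a) / d); [|apply Hm].
    apply Rle_trans with ((x - a) / d); [apply Hi|].
    apply Rmult_le_compat_r; [apply Rlt_le, Rinv_0_lt_compat, Hd|lra]. }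
  specialize (Hn i Him ltac:(lra)).
  set (z := a + INR i * d) in *.
  assert (Hz : a <= z <= b) by (unfold z; lra).
  assert (Hxz : Rabs (x - z) <= d) by (apply Rabs_le; unfold z; lra).
  assert (HCz : C * Rabs (x - z) <= e / 3).
  { apply Rle_trans with (C * d); [apply Rmult_le_compat_l; assumption|assumption]. }
  assert (H1 := Hf n x z Hx Hz). assert (H2 := Hg z x Hz Hx).
  rewrite (Rabs_minus_sym z x) in H2.
  assert (H3 := Rle_abs (f n x - f n z)). assert (H4 := Rle_abs (g z - g x)). lra.
Qed.

(* A decreasing limit of solutions coincides on compact intervals with the
   solution of a linear problem, hence is a solution. *)
Lemma decreasing_limit_solution {q s K : R} {F : R -> R} (H : bistable q s K F)
  (k c d : R) (u u1 : nat -> R -> R) (U : R -> R) :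
  (forall n t, c < t < d -> log_ode k q F (u n) (u1 n) t /\ 0 <= u n t <= s) ->
  (forall n t, c < t < d -> u (S n) t <= u n t) ->
  (forall t, c < t < d -> is_lim_seq (fun n => u n t) (U t)) ->
  forall t, c < t < d -> log_ode k q F U (Derive U) t.
Proof.
  intros Hu Hdec Hlim t0 Ht0.
  assert (Hq := bistable_q _ _ _ _ H). assert (HK := bistable_K _ _ _ _ H).
  set (a := (c + t0) / 2). set (b := (t0 + d) / 2).
  assert (Ha : c < a < t0) by (unfold a; lra).
  assert (Hb : t0 < b < d) by (unfold b; lra).
  assert (Hab : a < b) by lra. clearbody a b.
  set (C := exp (Rabs k * (b - a)) * (s / (b - a) + (q + K * exp (2 * b)) * s * (b - a))).
  assert (HuL : forall n x y, a <= x <= b -> a <= y <= b ->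
    Rabs (u n x - u n y) <= C * Rabs (x - y)).
  { intros n. apply (lipschitz_of_derivative_bound (u n) (u1 n)).
    - intros t Ht. apply (Hu n t ltac:(lra)).
    - apply (log_ode_derivative_bound H k (u n) (u1 n) a b Hab).
      intros t Ht. apply Hu. lra. }
  assert (Hlim' : forall x, a <= x <= b -> is_lim_seq (fun n => u n x) (U x))
    by (intros; apply Hlim; lra).
  assert (HUL := lipschitz_limit u U a b C HuL Hlim').
  assert (HC : 0 <= C).
  { specialize (HUL a b ltac:(lra) ltac:(lra)).
    assert (H0 := Rabs_pos (U a - U b)).
    assert (H1 : 0 < Rabs (a - b)) by (apply Rabs_pos_lt; lra).
    apply Rnot_lt_le. intros HC. nra. }
  assert (HUs : forall x, a <= x <= b -> 0 <= U x <= s).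
  { intros x Hx. split.
    - apply (is_lim_seq_const_le (fun n => u n x)); [now apply Hlim'|]. intros n. apply Hu. lra.
    - apply (is_lim_seq_le_const (fun n => u n x)); [now apply Hlim'|]. intros n. apply Hu. lra. }
  assert (HUu : forall n x, a <= x <= b -> U x <= u n x).
  { intros n x Hx.
    apply (is_lim_seq_le_const (fun m => u (m + n)%nat x)).
    - apply (is_lim_seq_incr_n (fun n => u n x)). now apply Hlim'.
    - intros m. apply (decreasing_seq_le (fun n => u n x)); [|lia].
      intros; apply Hdec; lra. }
  set (Uc := fun t => U (clamp a b t)).
  assert (HUc := lipschitz_continuous Uc C (lipschitz_clamp U a b C (Rlt_le _ _ Hab) HC HUL)).
  destruct (linear_bvp k q (fun t => exp (2 * t) * F (Uc t)) a b (U a) (U b) Hq Hab)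
    as [V [V1 [HV [HVa HVb]]]].
  { intros t. apply (continuous_mult (fun t => exp (2 * t)) (fun t => F (Uc t))).
    - apply (ex_derive_continuous (fun t => exp (2 * t))). auto_derive; trivial.
    - apply (continuous_comp Uc F); [apply HUc|apply (bistable_continuous _ _ _ _ H)]. }
  assert (HUV : forall x, a <= x <= b -> U x = V x).
  { assert (Happ : forall e, 0 < e -> exists n,
        (forall x, a <= x <= b -> u n x <= V x + e) /\
        (forall x, a <= x <= b -> V x <= U x + 2 * e)).
    { intros e He.
      set (M := K * exp (2 * b)).
      assert (HM : 0 < M) by (apply Rmult_lt_0_compat; [assumption|apply exp_pos]).
      (* Closeness within [eta <= e] handles the end points, and [M * eta <= q * e] makes the error
         in the nonlinearity fit the slack of [linear_comparison]. *)
      set (eta := Rmin e (q * e / M)).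
      assert (Heta : 0 < eta /\ eta <= e /\ M * eta <= q * e).
      { assert (0 < q * e) by (apply Rmult_lt_0_compat; assumption).
        split; [apply Rmin_glb_lt; [assumption|apply Rdiv_lt_0_compat; assumption]|].
        split; [apply Rmin_l|].
        replace (q * e) with (M * (q * e / M)) by (field; lra).
        apply Rmult_le_compat_l; [lra|apply Rmin_r]. }
      destruct (uniform_of_lipschitz_decreasing u U a b C eta) as [n Hn]; try tauto.
      { intros n x Hx. apply Hdec. lra. }
      assert (Hgn : forall x, a <= x <= b ->
        Rabs (exp (2 * x) * F (Uc x) - exp (2 * x) * F (u n x)) <= q * e).
      { intros x Hx. unfold Uc. rewrite clamp_id by assumption.
        rewrite <- Rmult_minus_distr_l, Rabs_mult.
        rewrite (Rabs_right (exp _)) by (apply Rle_ge, Rlt_le, exp_pos).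
        assert (HL := bistable_lipschitz _ _ _ _ H (U x) (u n x) (HUs x Hx)
           (proj2 (Hu n x ltac:(lra)))).
        assert (H1 := HUu n x Hx). assert (H2 := Hn x Hx).
        rewrite Rabs_minus_sym in HL. rewrite Rabs_minus_sym.
        rewrite (Rabs_left1 (U x - u n x)) in HL by lra.
        apply Rle_trans with (exp (2 * b) * (K * eta)); [|unfold M in Heta; lra].
        apply Rmult_le_compat; [apply Rlt_le, exp_pos|apply Rabs_pos|apply exp_le; lra|].
        apply Rle_trans with (K * - (U x - u n x)); [assumption|].
        apply Rmult_le_compat_l; lra. }
      assert (Hun : forall x, a <= x <= b ->
         linear_ode k q (fun t => exp (2 * t) * F (u n t)) (u n) (u1 n) x)
        by (intros x Hx; apply Hu; lra).
      exists n. split.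
      - apply (linear_comparison k q e (fun t => exp (2 * t) * F (u n t))
          (fun t => exp (2 * t) * F (Uc t)) (u n) (u1 n) V V1 a b Hq); try lra.
        + exact Hun.
        + intros; apply HV.
        + intros x Hx. simpl. assert (Hg := Hgn x Hx). apply Rabs_le_between in Hg. lra.
        + specialize (Hn a). lra.
        + specialize (Hn b). lra.
      - intros x Hx. apply Rle_trans with (u n x + e); [|specialize (Hn x Hx); lra].
        revert x Hx.
        apply (linear_comparison k q e (fun t => exp (2 * t) * F (Uc t))
                 (fun t => exp (2 * t) * F (u n t)) V V1 (u n) (u1 n) a b Hq ltac:(lra)
                 (fun x _ => HV x) Hun).
        + intros x Hx. simpl. assert (Hg := Hgn x Hx). apply Rabs_le_between in Hg. lra.
        + specialize (HUu n a). lra.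
        + specialize (HUu n b). lra. }
    intros x Hx. apply Rle_antisym; apply le_epsilon; intros e He.
    - destruct (Happ e He) as [n [Hn _]]. specialize (Hn x Hx). specialize (HUu n x Hx). lra.
    - destruct (Happ (e / 2) ltac:(lra)) as [n [_ Hn]]. specialize (Hn x Hx). lra. }
  assert (Hloc : forall x, a < x < b -> locally x (fun y => V y = U y)).
  { intros x Hx. assert (Hm : 0 < Rmin (x - a) (b - x)) by (apply Rmin_glb_lt; lra).
    exists (mkposreal _ Hm). intros y Hy. symmetry. apply HUV.
    change (Rabs (y - x) < Rmin (x - a) (b - x)) in Hy. apply Rabs_def2 in Hy.
    assert (Hm1 := Rmin_l (x - a) (b - x)). assert (Hm2 := Rmin_r (x - a) (b - x)). lra. }
  assert (HdU : forall x, a < x < b -> is_derive U x (V1 x)).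
  { intros x Hx. apply (is_derive_ext_loc V U x _ (Hloc x Hx)). apply HV. }
  split.
  - rewrite (is_derive_unique U t0 (V1 t0)); [|apply HdU; lra]. apply HdU; lra.
  - destruct (HV t0) as [_ HV2].
    rewrite (is_derive_unique U t0 (V1 t0)) by (apply HdU; lra).
    evar_last.
    + apply (is_derive_ext_loc V1 (Derive U) t0); [|exact HV2].
      assert (Hm : 0 < Rmin (t0 - a) (b - t0)) by (apply Rmin_glb_lt; lra).
      exists (mkposreal _ Hm). intros y Hy. symmetry. apply is_derive_unique, HdU.
      change (Rabs (y - t0) < Rmin (t0 - a) (b - t0)) in Hy. apply Rabs_def2 in Hy.
      assert (Hm1 := Rmin_l (t0 - a) (b - t0)). assert (Hm2 := Rmin_r (t0 - a) (b - t0)). lra.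
    + unfold Uc. rewrite clamp_id by lra. rewrite (HUV t0) by lra. ring.
Qed.

(** * Sliding comparison *)

Lemma Rbar_lt_ball (x : R) (T : Rbar) :
  Rbar_lt x T -> exists d, 0 < d /\ forall y, Rabs (y - x) < d -> Rbar_lt y T.
Proof.
  destruct T as [T| |]; simpl; intros H; [| |contradiction].
  - exists (T - x). split; [lra|]. intros y Hy. apply Rabs_def2 in Hy. lra.
  - exists 1. split; [lra|trivial].
Qed.

Lemma Rbar_lt_between (x : R) (T : Rbar) :
  Rbar_lt x T -> exists y : R, x < y /\ Rbar_lt y T.
Proof.
  intros H. destruct (Rbar_lt_ball x T H) as [d [Hd Hb]].
  exists (x + d / 2). split; [lra|]. apply Hb. apply Rabs_def1; lra.
Qed.

Lemma Rle_Rbar_lt (x y : R) (T : Rbar) : x <= y -> Rbar_lt y T -> Rbar_lt x T.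
Proof. intros H. exact (Rbar_le_lt_trans x y T H). Qed.

Lemma Rbar_lt_shift (t a : R) (T : Rbar) :
  Rbar_lt t (Rbar_minus T a) <-> Rbar_lt (t + a) T.
Proof. destruct T as [T| |]; simpl; split; intros; try easy; lra. Qed.

Lemma is_derive_shift (f : R -> R) (a t l : R) :
  is_derive f (t + a) l -> is_derive (fun t => f (t + a)) t l.
Proof.
  intros Hf.
  assert (Hs : is_derive (fun t => t + a) t 1) by (auto_derive; [trivial|ring]).
  evar_last; [exact (is_derive_comp f (fun t => t + a) t l 1 Hf Hs)|].
  apply Rmult_1_l.
Qed.

(** The domain is not compact; the reference value [f t1], which nothing outside [x, y] undercuts,
    turns the minimum over [x, y] into a global one. *)
Lemma global_min_exists (T : Rbar) (f : R -> R) (x y t1 : R) :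
  (forall t : R, Rbar_lt t T -> continuity_pt f t) ->
  Rbar_lt y T -> x <= t1 <= y ->
  (forall t : R, Rbar_lt t T -> t < x \/ y < t -> f t1 <= f t) ->
  exists m, x <= m <= y /\ forall t : R, Rbar_lt t T -> f m <= f t.
Proof.
  intros Hc Hy Ht1 Hout.
  destruct (continuity_ab_min f x y) as [m [Hm Hmxy]]; [lra| |].
  { intros t Ht. apply Hc, (Rle_Rbar_lt t y); tauto. }
  exists m. split; [assumption|]. intros t Ht.
  destruct (Rlt_le_dec t x) as [H1|H1].
  { apply Rle_trans with (f t1); [now apply Hm|]. apply Hout; tauto. }
  destruct (Rlt_le_dec y t) as [H2|H2].
  { apply Rle_trans with (f t1); [now apply Hm|]. apply Hout; tauto. }
  apply Hm. lra.
Qed.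

Lemma global_min_test (T : Rbar) (f f1 : R -> R) (m l : R) :
  (forall t : R, Rbar_lt t T -> is_derive f t (f1 t)) ->
  Rbar_lt m T -> is_derive f1 m l ->
  (forall t : R, Rbar_lt t T -> f m <= f t) -> f1 m = 0 /\ 0 <= l.
Proof.
  intros Hd Hm Hl Hmin. destruct (Rbar_lt_ball m T Hm) as [d [Hd0 Hb]].
  apply (second_derivative_at_min f f1 m l d); auto.
Qed.

(* Here [T = ln b], and [Rbar_lt t T] describes the domain; [U1] is the
   derivative of [U]. *)
Record profile (k q s : R) (F : R -> R) (T : Rbar) (U U1 : R -> R) : Prop := {
  profile_ode : forall t : R, Rbar_lt t T -> log_ode k q F U U1 t;
  profile_nonneg : forall t : R, Rbar_lt t T -> 0 <= U t;
  profile_start : forall e, 0 < e ->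
    exists t0 : R, Rbar_lt t0 T /\ forall t, t < t0 -> U t < e;
  profile_end : forall e, 0 < e ->
    exists t0 : R, Rbar_lt t0 T /\
      forall t, t0 < t -> Rbar_lt t T -> Rabs (U t - s) < e
}.

Section Comparison.
Context {k q s K : R} {F : R -> R} (H : bistable q s K F).

(** At a global maximum of value at least [s] the equation gives a second derivative
    [q * U + exp (2 * t) * F U], which is positive because [F >= 0] from [s] on. A value above [s]
    would produce such a maximum, by the limits 0 and [s]; so would the value [s] itself. *)
Lemma profile_lt {T : Rbar} {U U1 : R -> R} (P : profile k q s F T U U1) (t : R) :
  Rbar_lt t T -> U t < s.
Proof.
  intros Ht.
  assert (Hq := bistable_q _ _ _ _ H). assert (Hs := bistable_s _ _ _ _ H).
  assert (Hcrit : forall m : R, Rbar_lt m T -> s <= U m ->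
     ~ (forall t : R, Rbar_lt t T -> U t <= U m)).
  { intros m Hm Hsm Hmax.
    destruct (profile_ode _ _ _ _ _ _ _ P m Hm) as [_ Hm2].
    destruct (global_min_test T (fun t => - U t) (fun t => - U1 t) m
      (- (q * U m + exp (2 * m) * F (U m) - k * U1 m))) as [H1 H2]; trivial.
    - intros r Hr. apply (is_derive_opp U r (U1 r)).
      apply (profile_ode _ _ _ _ _ _ _ P r Hr).
    - exact (is_derive_opp U1 m _ Hm2).
    - intros r Hr. specialize (Hmax r Hr). lra.
    - assert (HF : 0 <= F (U m)).
      { destruct Hsm as [Hsm| <-]; [now apply (bistable_nonneg _ _ _ _ H)|].
        rewrite (bistable_one _ _ _ _ H). lra. }
      assert (0 <= exp (2 * m) * F (U m)) by (apply Rmult_le_pos; [apply Rlt_le, exp_pos|assumption]).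
      assert (0 < q * U m) by (apply Rmult_lt_0_compat; lra).
      replace (U1 m) with 0 in H2 by lra. lra. }
  assert (Hle : forall r : R, Rbar_lt r T -> U r <= s).
  { intros r Hr. apply Rnot_lt_le. intros Hsr.
    destruct (profile_start _ _ _ _ _ _ _ P (U r)) as [x [Hx HxU]]; [lra|].
    destruct (profile_end _ _ _ _ _ _ _ P (U r - s)) as [y [Hy HyU]]; [lra|].
    destruct (global_min_exists T (fun t => - U t) (Rmin x r) (Rmax y r) r) as [m [Hm Hmin]].
    - intros z Hz. apply (is_derive_continuity_pt _ z (- U1 z)).
      apply (is_derive_opp U z (U1 z)), (profile_ode _ _ _ _ _ _ _ P z Hz).
    - now apply Rmax_case.
    - split; [apply Rmin_r|apply Rmax_r].
    - intros z Hz [Hzx|Hzy].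
      + assert (Hm := Rmin_l x r). specialize (HxU z ltac:(lra)). lra.
      + assert (Hm := Rmax_l y r). specialize (HyU z ltac:(lra) Hz).
        apply Rabs_def2 in HyU. lra.
    - assert (HmT : Rbar_lt m T).
      { apply (Rle_Rbar_lt m (Rmax y r)); [apply Hm|]. now apply Rmax_case. }
      apply (Hcrit m HmT).
      + specialize (Hmin r Hr). lra.
      + intros z Hz. specialize (Hmin z Hz). lra. }
  destruct (Hle t Ht) as [Hlt|Heq]; [assumption|exfalso].
  apply (Hcrit t Ht); [lra|]. rewrite Heq. exact Hle.
Qed.

(* Hopf's lemma with the barrier [e (exp (al (t - t0)) - 1)]: a zero of [U]
   would be a minimum with positive derivative. *)
Lemma profile_pos {T : Rbar} {U U1 : R -> R} (P : profile k q s F T U U1) (t : R) :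
  Rbar_lt t T -> 0 < U t.
Proof.
  intros Ht.
  assert (Hq := bistable_q _ _ _ _ H). assert (Hs := bistable_s _ _ _ _ H).
  destruct (profile_nonneg _ _ _ _ _ _ _ P t Ht) as [Hlt|H0]; [assumption|exfalso].
  symmetry in H0.
  assert (Hb : exists b, t < b /\ Rbar_lt b T /\ 0 < U b).
  { destruct (profile_end _ _ _ _ _ _ _ P s Hs) as [y [Hy HyU]].
    destruct (Rbar_lt_between (Rmax t y) T) as [b [Hb HbT]]; [now apply Rmax_case|].
    assert (H1 := Rmax_l t y). assert (H2 := Rmax_r t y).
    exists b. split; [lra|split; [assumption|]].
    specialize (HyU b ltac:(lra) HbT). apply Rabs_def2 in HyU. lra. }
  destruct Hb as [b [Htb [HbT HUb]]].
  (* Large enough that [al * al + k * al > q], which makes the barrier a strict subsolution of the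
     linear equation; [F <= 0] makes [U] a supersolution. *)
  set (al := Rabs k + q + 1).
  assert (Hal : 0 < al) by (unfold al; assert (Hk := Rabs_pos k); lra).
  assert (Halq : 0 < al * al + k * al - q).
  { assert (Hk := Rle_abs (- k)). rewrite Rabs_Ropp in Hk. assert (Hk0 := Rabs_pos k).
    assert (al * (q + 1) <= al * (al + k)) by (apply Rmult_le_compat_l; [|unfold al]; lra).
    unfold al in *. nra. }
  clearbody al.
  set (g := fun r => exp (al * (r - t))).
  assert (Hgb : 1 < g b).
  { unfold g. rewrite <- exp_0. apply exp_increasing. apply Rmult_lt_0_compat; lra. }
  (* The barrier then agrees with [U] at both [t] and [b]. *)
  set (e := U b / (g b - 1)).
  assert (He : 0 < e) by (apply Rdiv_lt_0_compat; lra).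
  assert (Hg : forall c r, is_derive (fun r => c * (g r - 1)) r (c * al * g r)).
  { intros c r. unfold g. auto_derive; [trivial|]. unfold Rminus. ring. }
  assert (Hg' : forall c r, is_derive (fun r => c * g r) r (c * al * g r)).
  { intros c r. unfold g. auto_derive; [trivial|]. unfold Rminus. ring. }
  assert (HinT : forall r, r <= b -> Rbar_lt r T) by (intros r Hr; now apply (Rle_Rbar_lt r b)).
  assert (Hgt : g t = 1).
  { unfold g. rewrite Rminus_diag, Rmult_0_r. apply exp_0. }
  assert (Hd : forall r, r <= b -> is_derive (fun r => e * (g r - 1) - U r) r (e * al * g r - U1 r)).
  { intros r Hr. apply (is_derive_minus (fun r => e * (g r - 1)) U); [apply Hg|].
    apply (profile_ode _ _ _ _ _ _ _ P r (HinT r Hr)). }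
  assert (Hbar : forall r, t <= r <= b -> e * (g r - 1) - U r <= 0).
  { apply (maximum_principle (fun r => e * (g r - 1) - U r) (fun r => e * al * g r - U1 r)
      (fun r => e * al * al * g r - (q * U r + exp (2 * r) * F (U r) - k * U1 r))); [lra| | | | |].
    - intros r Hr. apply (is_derive_continuity_pt _ r _ (Hd r ltac:(lra))).
    - intros r Hr. split; [apply Hd; lra|].
      apply (is_derive_minus (fun r => e * al * g r) U1); [apply Hg'|].
      apply (profile_ode _ _ _ _ _ _ _ P r (HinT r ltac:(lra))).
    - rewrite Hgt, H0. lra.
    - replace (e * (g b - 1)) with (U b) by (unfold e; field; lra). lra.
    - intros r Hr Hpos HU1.
      assert (HrT := HinT r ltac:(lra)).
      assert (HF := bistable_le_0 H (U r) (conj (profile_nonneg _ _ _ _ _ _ _ P r HrT)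
         (Rlt_le _ _ (profile_lt P r HrT)))).
      assert (0 <= exp (2 * r) * - F (U r)) by (apply Rmult_le_pos; [apply Rlt_le, exp_pos|lra]).
      replace (U1 r) with (e * al * g r) by lra.
      assert (Hgr : 0 < g r) by apply exp_pos.
      assert (0 < e * g r * (al * al + k * al - q)) by (apply Rmult_lt_0_compat; [apply Rmult_lt_0_compat|]; assumption).
      assert (0 < q * (e * (g r - 1) - U r)) by (apply Rmult_lt_0_compat; assumption).
      assert (0 < q * e) by (apply Rmult_lt_0_compat; assumption). nra. }
  destruct (profile_ode _ _ _ _ _ _ _ P t Ht) as [_ Ht2].
  destruct (global_min_test T U U1 t _ (fun r Hr => proj1 (profile_ode _ _ _ _ _ _ _ P r Hr))
     Ht Ht2) as [HU1 _].
  { intros r Hr. rewrite H0. now apply (profile_nonneg _ _ _ _ _ _ _ P). }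
  destruct (increasing_right_of_positive_derivative _ t _ (Hd t ltac:(lra))) as [d [Hd0 Hinc]].
  { rewrite HU1, Hgt. assert (0 < e * al) by (apply Rmult_lt_0_compat; assumption). lra. }
  set (r := Rmin (t + d / 2) b).
  assert (Hr : t < r) by (apply Rmin_glb_lt; lra).
  assert (Hr1 := Rmin_l (t + d / 2) b : r <= _). assert (Hr2 := Rmin_r (t + d / 2) b : r <= _).
  specialize (Hinc r ltac:(lra)). specialize (Hbar r ltac:(lra)). simpl in Hinc.
  rewrite Hgt, H0 in Hinc. lra.
Qed.

Lemma profile_range {T : Rbar} {U U1 : R -> R} (P : profile k q s F T U U1) (t : R) :
  Rbar_lt t T -> 0 <= U t <= s.
Proof.
  intros Ht. split; [now apply (profile_nonneg _ _ _ _ _ _ _ P)|].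
  apply Rlt_le, (profile_lt P), Ht.
Qed.

Section Sliding.
Context {T T' : Rbar} {U U1 V V1 : R -> R}
  (PU : profile k q s F T U U1) (PV : profile k q s F T' V V1) (HT : Rbar_le T T').

Lemma sliding_domain (a t : R) :
  0 <= a -> Rbar_lt (t + a) T -> Rbar_lt t T /\ Rbar_lt t T'.
Proof.
  intros Ha Ht. assert (Rbar_lt t T) by (apply (Rle_Rbar_lt t (t + a)); [lra|assumption]).
  split; [assumption|]. now apply Rbar_lt_le_trans with T.
Qed.

Lemma sliding_derive (a t : R) :
  0 <= a -> Rbar_lt (t + a) T ->
  is_derive (fun t => U (t + a) - V t) t (U1 (t + a) - V1 t) /\
  is_derive (fun t => U1 (t + a) - V1 t) t
    ((q * U (t + a) + exp (2 * (t + a)) * F (U (t + a)) - k * U1 (t + a)) -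
     (q * V t + exp (2 * t) * F (V t) - k * V1 t)).
Proof.
  intros Ha Ht. destruct (sliding_domain a t Ha Ht) as [_ Ht'].
  destruct (profile_ode _ _ _ _ _ _ _ PU _ Ht) as [HU1 HU2].
  destruct (profile_ode _ _ _ _ _ _ _ PV _ Ht') as [HV1 HV2].
  split.
  - exact (is_derive_minus _ _ _ _ _ (is_derive_shift _ _ _ _ HU1) HV1).
  - exact (is_derive_minus _ _ _ _ _ (is_derive_shift _ _ _ _ HU2) HV2).
Qed.

(** At the minimum the first derivatives agree, so the terms in [k] cancel and only terms of order
    zero remain. *)
Lemma sliding_min_test (a m : R) :
  0 <= a -> Rbar_lt (m + a) T ->
  (forall t : R, Rbar_lt (t + a) T -> U (m + a) - V m <= U (t + a) - V t) ->
  0 <= q * (U (m + a) - V m) + exp (2 * (m + a)) * F (U (m + a)) - exp (2 * m) * F (V m).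
Proof.
  intros Ha Hm Hmin.
  destruct (sliding_derive a m Ha Hm) as [_ H2].
  destruct (global_min_test (Rbar_minus T a) (fun t => U (t + a) - V t)
    (fun t => U1 (t + a) - V1 t) m _
    (fun t Ht => proj1 (sliding_derive a t Ha (proj1 (Rbar_lt_shift _ _ _) Ht)))
    (proj2 (Rbar_lt_shift _ _ _) Hm) H2) as [H3 H4].
  - intros t Ht. now apply Hmin, Rbar_lt_shift.
  - replace (U1 (m + a)) with (V1 m) in H4 by lra. lra.
Qed.

(* A negative minimum of [U (t + a) - V t] is impossible where
   [K exp (2 t) < q] (the Lipschitz constant of [F] is beaten by [q]) and where
   both functions lie in the range in which [F] is nondecreasing. *)
Lemma sliding_negative_min (a d t1 : R) :
  (forall u v, s - d <= u -> u <= v -> v <= s -> F u <= F v) ->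
  0 <= a -> Rbar_lt (t1 + a) T -> U (t1 + a) < V t1 ->
  exists m, Rbar_lt (m + a) T /\ U (m + a) < V m /\
    q <= K * exp (2 * m) /\ U (m + a) < s - d.
Proof.
  intros Hd Ha Ht1 Hlt.
  assert (Hq := bistable_q _ _ _ _ H). assert (Hs := bistable_s _ _ _ _ H).
  (* Near -oo one has [V < e] and [U >= 0], and near the right end [U > s - e] and [V < s]; in both
     regions the difference stays above [- e], so its minimum is attained in between. *)
  set (e := V t1 - U (t1 + a)).
  destruct (profile_start _ _ _ _ _ _ _ PV e) as [x [_ HxV]]; [unfold e; lra|].
  destruct (profile_end _ _ _ _ _ _ _ PU e) as [y [Hy HyU]]; [unfold e; lra|].
  destruct (global_min_exists (Rbar_minus T a) (fun t => U (t + a) - V t)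
     (Rmin x t1) (Rmax (y - a) t1) t1) as [m [Hm Hmin]].
  - intros t Ht. apply Rbar_lt_shift in Ht.
    exact (is_derive_continuity_pt _ _ _ (proj1 (sliding_derive a t Ha Ht))).
  - apply Rbar_lt_shift. apply Rmax_case; [|assumption].
    now replace (y - a + a) with y by ring.
  - split; [apply Rmin_r|apply Rmax_r].
  - intros t Ht Hor. apply Rbar_lt_shift in Ht.
    destruct (sliding_domain a t Ha Ht) as [_ Ht'].
    destruct Hor as [Htx|Hty].
    + assert (Hx := Rmin_l x t1). specialize (HxV t ltac:(lra)).
      assert (H0 := profile_nonneg _ _ _ _ _ _ _ PU _ Ht). unfold e in HxV. lra.
    + assert (Hx := Rmax_l (y - a) t1). specialize (HyU (t + a) ltac:(lra) Ht).
      apply Rabs_def2 in HyU. assert (H0 := profile_lt PV _ Ht'). unfold e in HyU. lra.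
  - assert (HmT : Rbar_lt (m + a) T).
    { apply (Rle_Rbar_lt (m + a) (Rmax (y - a) t1 + a)); [lra|].
      apply Rmax_case; [|assumption]. now replace (y - a + a) with y by ring. }
    destruct (sliding_domain a m Ha HmT) as [_ HmT'].
    assert (Hneg := Hmin t1 (proj2 (Rbar_lt_shift _ _ _) Ht1)). simpl in Hneg.
    assert (Htest := sliding_min_test a m Ha HmT
      (fun t Ht => Hmin t (proj2 (Rbar_lt_shift _ _ _) Ht))).
    assert (HUr := profile_range PU _ HmT). assert (HVr := profile_range PV _ HmT').
    assert (HF := bistable_le_0 H _ HUr).
    assert (Hexp : exp (2 * m) <= exp (2 * (m + a))) by (apply exp_le; lra).
    assert (He0 := exp_pos (2 * m)).
    (* Since [F <= 0] on [0, s], the weight at [m + a] may be replaced by the smaller one at [m]: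
       the translate is a supersolution. *)
    assert (Hm1 : (exp (2 * (m + a)) - exp (2 * m)) * - F (U (m + a)) >= 0).
    { apply Rle_ge, Rmult_le_pos; lra. }
    assert (Hdiff : q * (V m - U (m + a)) <= exp (2 * m) * (F (U (m + a)) - F (V m))) by lra.
    assert (Hpos : 0 < q * (V m - U (m + a))) by (apply Rmult_lt_0_compat; lra).
    exists m. split; [assumption|split; [lra|split]].
    + assert (HL := bistable_lipschitz _ _ _ _ H _ _ HUr HVr).
      rewrite (Rabs_left (U (m + a) - V m)) in HL by lra.
      assert (HL1 := Rle_abs (F (U (m + a)) - F (V m))).
      assert (exp (2 * m) * (F (U (m + a)) - F (V m)) <= exp (2 * m) * (K * (V m - U (m + a))))
        by (apply Rmult_le_compat_l; lra).
      apply Rmult_le_reg_r with (V m - U (m + a)); lra.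
    + apply Rnot_le_lt. intros Hsd.
      assert (HFF := Hd (U (m + a)) (V m) Hsd ltac:(lra) ltac:(lra)).
      assert (exp (2 * m) * (F (V m) - F (U (m + a))) >= 0) by (apply Rle_ge, Rmult_le_pos; lra).
      lra.
Qed.

(* At a contact point [c = U (m + a) = V m] the second derivatives force
   [exp (2 (m + a)) F c >= exp (2 m) F c], against [F c < 0]. *)
Lemma sliding_no_contact (a m : R) :
  0 < a -> Rbar_lt (m + a) T ->
  (forall t : R, Rbar_lt (t + a) T -> V t <= U (t + a)) -> V m < U (m + a).
Proof.
  intros Ha HmT Hle. destruct (Hle m HmT) as [Hlt|Htouch]; [assumption|exfalso].
  assert (Htest := sliding_min_test a m (Rlt_le _ _ Ha) HmT).
  rewrite <- Htouch in Htest.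
  destruct (sliding_domain a m (Rlt_le _ _ Ha) HmT) as [_ HmT'].
  assert (HF := bistable_neg _ _ _ _ H (V m)
     (conj (profile_pos PV m HmT') (profile_lt PV m HmT'))).
  assert (Hexp : exp (2 * m) < exp (2 * (m + a))) by (apply exp_increasing; lra).
  assert (0 < (exp (2 * (m + a)) - exp (2 * m)) * - F (V m)) by (apply Rmult_lt_0_compat; lra).
  assert (0 <= q * (V m - V m) + exp (2 * (m + a)) * F (V m) - exp (2 * m) * F (V m)).
  { apply Htest. intros r Hr. specialize (Hle r Hr). lra. }
  lra.
Qed.

(** Three uses: [a = 0] with equal end points gives uniqueness, [a = 0] with [T <= T'] makes the
    approximations decrease as the end point grows, and [U = V] gives monotonicity. *)
Lemma profile_comparison (t a : R) : 0 <= a -> Rbar_lt (t + a) T -> V t <= U (t + a).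
Proof.
  intros Ha Hta. apply Rnot_lt_le. intros Hlt.
  assert (Hq := bistable_q _ _ _ _ H). assert (HK := bistable_K _ _ _ _ H).
  (* The set of violating shifts is open to the right, so its supremum [c] is not a violating shift;
     it is bounded because the negative minima stay in a fixed range. *)
  set (B := fun a => 0 <= a /\ exists t, Rbar_lt (t + a) T /\ U (t + a) < V t).
  assert (HBa : B a) by (split; [assumption|now exists t]).
  assert (Hopen : forall a, B a -> exists a', a < a' /\ B a').
  { clear - PU. intros a [Ha [t [Ht Hlt]]].
    destruct (profile_ode _ _ _ _ _ _ _ PU _ Ht) as [HU _].
    apply is_derive_continuity_pt in HU.
    destruct (Rbar_lt_ball _ _ Ht) as [d [Hd Hball]].
    destruct (HU (V t - U (t + a))) as [d' [Hd' Hc]]; [lra|].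
    set (h := Rmin d d' / 2).
    assert (Hh : 0 < h /\ h < d /\ h < d').
    { assert (H1 := Rmin_l d d'). assert (H2 := Rmin_r d d').
      assert (0 < Rmin d d') by (apply Rmin_glb_lt; assumption). unfold h. lra. }
    exists (a + h). split; [lra|]. split; [lra|]. exists t. split.
    - apply Hball. apply Rabs_def1; lra.
    - specialize (Hc (t + (a + h))). simpl in Hc. unfold R_dist in Hc.
      assert (Hc' : Rabs (U (t + (a + h)) - U (t + a)) < V t - U (t + a)).
      { apply Hc. split; [split; [exact I|lra]|]. apply Rabs_def1; lra. }
      apply Rabs_def2 in Hc'. lra. }
  destruct (bistable_stable _ _ _ _ H) as [d [Hd Hstab]].
  destruct (profile_end _ _ _ _ _ _ _ PU d) as [X [HX HXU]]; [lra|].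
  (* Violating minima satisfy [m + a <= X]. The margin up to [X'] keeps [m + c] inside the domain
     when [a] is slightly smaller than [c]. *)
  destruct (Rbar_lt_between X T HX) as [X' [HXX' HX'T]].
  (* The solution of [K * exp (2 * t0) = q]. *)
  set (t0 := ln (q / K) / 2).
  assert (Hmin : forall a, B a -> exists m, t0 <= m /\ m + a <= X /\ U (m + a) < V m).
  { intros b [Hb [r [Hr Hrlt]]].
    destruct (sliding_negative_min b d r Hstab Hb Hr Hrlt) as [m [Hm [Hmlt [Hmq HmU]]]].
    exists m. split; [|split; [|assumption]].
    - assert (Hl : ln (q / K) <= ln (exp (2 * m))).
      { apply ln_le; [apply Rdiv_lt_0_compat; assumption|].
        apply Rmult_le_reg_l with K; [assumption|].
        replace (K * (q / K)) with q by (field; lra). assumption. }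
      rewrite ln_exp in Hl. unfold t0. lra.
    - apply Rnot_lt_le. intros HXm. specialize (HXU (m + b) HXm Hm).
      apply Rabs_def2 in HXU. lra. }
  destruct (completeness B) as [c [Hub Hlub]].
  { exists (X - t0). intros b Hb. destruct (Hmin b Hb) as [m Hm]. lra. }
  { now exists a. }
  assert (Hac : 0 < c).
  { destruct (Hopen a HBa) as [a' [Haa' HBa']]. specialize (Hub a' HBa'). lra. }
  assert (HnB : forall t : R, Rbar_lt (t + c) T -> V t <= U (t + c)).
  { intros r Hr. apply Rnot_lt_le. intros Hrlt.
    assert (HBc : B c) by (split; [lra|now exists r]).
    destruct (Hopen c HBc) as [c' [Hc HBc']]. specialize (Hub c' HBc'). lra. }
  assert (Happ : forall e, 0 < e -> exists b, B b /\ c - e < b).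
  { intros e He. apply NNPP. intros Hn.
    assert (c <= c - e); [|lra]. apply Hlub. intros b Hb. apply Rnot_lt_le.
    intros Hcb. apply Hn. now exists b. }
  assert (Hne : t0 <= X' - c).
  { destruct (Happ (X' - X)) as [b [Hb Hcb]]; [lra|].
    destruct (Hmin b Hb) as [m Hm]. lra. }
  destruct (continuity_ab_min (fun t => U (t + c) - V t) t0 (X' - c) Hne) as [m [Hmm Hm]].
  { intros r Hr. refine (is_derive_continuity_pt _ _ _ (proj1 (sliding_derive c r _ _))); [lra|].
    apply (Rle_Rbar_lt _ X'); [lra|assumption]. }
  assert (HmT : Rbar_lt (m + c) T) by (apply (Rle_Rbar_lt _ X'); [lra|assumption]).
  destruct (Rle_lt_or_eq_dec (V m) (U (m + c)) (HnB m HmT)) as [Hpos|Htouch].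
  (* A positive gap [mu] at shift [c] would persist, by the Lipschitz bound on [U], for all shifts
     within [mu / (C + 1)] below [c], but violating shifts accumulate at [c]. *)
  - assert (Hlip : exists C, 0 <= C /\ forall x y, t0 <= x <= X' -> t0 <= y <= X' ->
      Rabs (U x - U y) <= C * Rabs (x - y)).
    { set (C := exp (Rabs k * (X' - t0)) * (s / (X' - t0) + (q + K * exp (2 * X')) * s * (X' - t0))).
      assert (HC : forall t, t0 <= t <= X' -> Rabs (U1 t) <= C).
      { apply (log_ode_derivative_bound H k U U1); [lra|].
        intros r Hr. assert (HrT : Rbar_lt r T) by (apply (Rle_Rbar_lt _ X'); [lra|assumption]).
        split; [apply (profile_ode _ _ _ _ _ _ _ PU _ HrT)|apply (profile_range PU _ HrT)]. }
      exists C. split; [eapply Rle_trans; [apply Rabs_pos|apply (HC t0); lra]|].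
      apply (lipschitz_of_derivative_bound U U1); [|assumption].
      intros r Hr. apply (profile_ode _ _ _ _ _ _ _ PU). apply (Rle_Rbar_lt _ X'); [lra|assumption]. }
    destruct Hlip as [C [HC Hlip]].
    set (mu := U (m + c) - V m) in *.
    set (e := Rmin (X' - X) (mu / (C + 1))).
    assert (He1 := Rmin_l (X' - X) (mu / (C + 1)) : e <= _).
    assert (He2 := Rmin_r (X' - X) (mu / (C + 1)) : e <= _).
    assert (Hmu : 0 < mu) by (unfold mu; lra).
    destruct (Happ e) as [b [Hb Hcb]].
    { apply Rmin_glb_lt; [lra|]. apply Rdiv_lt_0_compat; lra. }
    assert (Hbc := Hub b Hb). destruct (Hmin b Hb) as [r [Hr1 [Hr2 Hr3]]].
    assert (Hb0 := proj1 Hb).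
    assert (Hmr := Hmm r ltac:(lra)). simpl in Hmr. fold mu in Hmr.
    assert (HL := Hlip (r + c) (r + b) ltac:(lra) ltac:(lra)).
    assert (HL1 := Rle_abs (U (r + c) - U (r + b))).
    replace (r + c - (r + b)) with (c - b) in HL by ring.
    rewrite (Rabs_right (c - b)) in HL by lra.
    assert (C * (c - b) <= C * (mu / (C + 1))) by (apply Rmult_le_compat_l; lra).
    assert (C * (mu / (C + 1)) < mu).
    { assert (0 < mu / (C + 1)) by (apply Rdiv_lt_0_compat; lra).
      assert ((C + 1) * (mu / (C + 1)) = mu) by (field; lra). lra. }
    lra.
  - assert (Hstrict := sliding_no_contact c m Hac HmT HnB). lra.
Qed.

Lemma profile_comparison_strict (t a : R) :
  0 < a -> Rbar_lt (t + a) T -> V t < U (t + a).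
Proof.
  intros Ha Ht. apply sliding_no_contact; trivial.
  intros r Hr. apply profile_comparison; [lra|assumption].
Qed.
End Sliding.
End Comparison.

(** * Solutions on half-lines bounded above *)

(** [I n] is the set where [u n] is under control. Stating the limit for increasing sets covers both
    exhaustions, by the left end and by the right end. The last two conclusions transfer upper and
    lower bounds, by which the boundary behaviour of the limit is recovered. *)
Lemma exhausting_limit_solution {q s K : R} {F : R -> R} (H : bistable q s K F)
  (k : R) (T : Rbar) (I : nat -> R -> Prop) (u u1 : nat -> R -> R) :
  (forall n t, I n t -> I (S n) t) ->
  (forall t : R, Rbar_lt t T -> exists n c d, c < t < d /\ forall r, c < r < d -> I n r) ->
  (forall n t, I n t -> log_ode k q F (u n) (u1 n) t /\ 0 <= u n t <= s) ->
  (forall n t, I n t -> u (S n) t <= u n t) ->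
  exists U, forall t : R, Rbar_lt t T ->
    log_ode k q F U (Derive U) t /\ 0 <= U t <= s /\
    (forall n, I n t -> U t <= u n t) /\
    (forall c N, (forall n, (N <= n)%nat -> I n t -> c <= u n t) -> c <= U t).
Proof.
  intros HI HT Hu Hdec.
  assert (HI' : forall n m t, (n <= m)%nat -> I n t -> I m t).
  { intros n m t Hnm Hn. induction Hnm as [|m _ IH]; auto. }
  assert (Hlim : forall n t, I n t ->
     is_lim_seq (fun m => u (m + n)%nat t) (real (Lim_seq (fun m => u m t)))).
  { intros n t Hn.
    assert (Hm : forall m, I (m + n)%nat t) by (intros m; apply (HI' n); [lia|assumption]).
    rewrite <- (Lim_seq_incr_n (fun m => u m t) n). apply Lim_seq_correct'.
    apply (ex_finite_lim_seq_decr _ 0).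
    - intros m. exact (Hdec _ _ (Hm m)).
    - intros m. apply (proj2 (Hu _ _ (Hm m))). }
  exists (fun t => real (Lim_seq (fun m => u m t))). intros t Ht.
  destruct (HT t Ht) as [n [c [d [Htcd Hcd]]]].
  assert (Hn : I n t) by now apply Hcd.
  split; [|split; [|split]].
  - apply (decreasing_limit_solution H k c d (fun m => u (m + n)%nat) (fun m => u1 (m + n)%nat)); trivial.
    + intros m r Hr. apply Hu, (HI' n); [lia|now apply Hcd].
    + intros m r Hr. apply (Hdec (m + n)%nat), (HI' n); [lia|now apply Hcd].
    + intros r Hr. apply Hlim. now apply Hcd.
  - split.
    + apply (is_lim_seq_const_le (fun m => u (m + n)%nat t)); [now apply Hlim|].
      intros m. apply Hu, (HI' n); [lia|assumption].
    + apply (is_lim_seq_le_const (fun m => u (m + n)%nat t)); [now apply Hlim|].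
      intros m. apply Hu, (HI' n); [lia|assumption].
  - intros m Hm. apply (is_lim_seq_le_const (fun j => u (j + m)%nat t)); [now apply Hlim|].
    intros j. apply (decreasing_seq_le (fun j => u (j + m)%nat t)) with (n := 0%nat) (m := j); [|lia].
    intros i. apply (Hdec (i + m)%nat), (HI' m); [lia|assumption].
  - intros x N Hx.
    apply (is_lim_seq_const_le (fun m => u (m + (n + N))%nat t)).
    + apply Hlim, (HI' n); [lia|assumption].
    + intros m. apply Hx; [lia|]. apply (HI' n); [lia|assumption].
Qed.

(** A sum of two exponentials, each equal to [s] at one end, is a supersolution: half of [q] absorbs
    [g * g + Rabs k * g], the other half the nonlinearity, which is small for [t <= b]. As [a] tends
    to -oo the first term disappears and the second gives exponential decay. *)
Lemma start_barrier {q s K : R} {F : R -> R} (H : bistable q s K F)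
  (k g a b : R) (W W1 : R -> R) :
  0 < g -> g * g + Rabs k * g <= q / 2 -> K * exp (2 * b) <= q / 2 -> a <= b ->
  (forall t, a <= t <= b -> log_ode k q F W W1 t /\ 0 <= W t <= s) ->
  forall t, a <= t <= b -> W t <= s * exp (- g * (t - a)) + s * exp (g * (t - b)).
Proof.
  intros Hg Hgk Hb Hab HW t Ht.
  assert (Hq := bistable_q _ _ _ _ H). assert (Hs := bistable_s _ _ _ _ H).
  assert (HK := bistable_K _ _ _ _ H).
  set (E1 := fun t => s * exp (- g * (t - a))). set (E2 := fun t => s * exp (g * (t - b))).
  assert (HE : forall t, 0 < E1 t /\ 0 < E2 t).
  { intros r. split; apply Rmult_lt_0_compat; trivial; apply exp_pos. }
  assert (HE1 : forall t, is_derive E1 t (- g * E1 t)).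
  { intros r. unfold E1. auto_derive; [trivial|]. unfold Rminus. ring. }
  assert (HE2 : forall t, is_derive E2 t (g * E2 t)).
  { intros r. unfold E2. auto_derive; [trivial|]. unfold Rminus. ring. }
  assert (Hd : forall r, a <= r <= b ->
    is_derive (fun t => W t - (E1 t + E2 t)) r (W1 r - (- g * E1 r + g * E2 r))).
  { intros r Hr. apply (is_derive_minus W (fun t => E1 t + E2 t)).
    - apply (HW r Hr).
    - apply (is_derive_plus E1 E2); auto. }
  assert (Hle : W t - (E1 t + E2 t) <= 0); [|unfold E1, E2 in *; lra].
  revert t Ht.
  apply (maximum_principle _ (fun r => W1 r - (- g * E1 r + g * E2 r))
    (fun r => q * W r + exp (2 * r) * F (W r) - k * W1 r - (g * g * E1 r + g * g * E2 r)) a b Hab).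
  - intros r Hr. exact (is_derive_continuity_pt _ r _ (Hd r Hr)).
  - intros r Hr. split; [apply Hd; lra|].
    apply (is_derive_minus W1 (fun r => - g * E1 r + g * E2 r)).
    + apply (HW r ltac:(lra)).
    + evar_last.
      * apply (is_derive_plus (fun r => - g * E1 r) (fun r => g * E2 r)).
        -- exact (is_derive_scal E1 r (- g) _ (HE1 r)).
        -- exact (is_derive_scal E2 r g _ (HE2 r)).
      * unfold plus; simpl. ring.
  - assert (HWa := proj2 (HW a ltac:(lra))). destruct (HE a) as [_ H2].
    assert (E1 a = s) by (unfold E1; rewrite Rminus_diag, Rmult_0_r, exp_0; ring). lra.
  - assert (HWb := proj2 (HW b ltac:(lra))). destruct (HE b) as [H1 _].
    assert (E2 b = s) by (unfold E2; rewrite Rminus_diag, Rmult_0_r, exp_0; ring). lra.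
  - intros r Hr Hpos HW1.
    destruct (HW r ltac:(lra)) as [_ HWr]. destruct (HE r) as [H1 H2].
    assert (HF := bistable_lower H _ HWr).
    assert (He : exp (2 * r) <= exp (2 * b)) by (apply exp_le; lra).
    assert (He0 := exp_pos (2 * r)).
    assert (HF1 : exp (2 * r) * - (K * W r) <= exp (2 * r) * F (W r)) by (apply Rmult_le_compat_l; lra).
    assert (HK1 : exp (2 * r) * (K * W r) <= exp (2 * b) * (K * W r))
      by (apply Rmult_le_compat_r; [apply Rmult_le_pos|]; lra).
    assert (HK2 : K * exp (2 * b) * W r <= q / 2 * W r) by (apply Rmult_le_compat_r; lra).
    replace (W1 r) with (- g * E1 r + g * E2 r) by lra.
    assert (Hk1 := Rle_abs k). assert (Hk2 := Rle_abs (- k)). rewrite Rabs_Ropp in Hk2.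
    assert (Hg1 : - (k * g) * E1 r <= Rabs k * g * E1 r).
    { apply Rmult_le_compat_r; [lra|]. nra. }
    assert (Hg2 : k * g * E2 r <= Rabs k * g * E2 r).
    { apply Rmult_le_compat_r; [lra|]. nra. }
    assert (Hg3 : (g * g + Rabs k * g) * (E1 r + E2 r) <= q / 2 * (E1 r + E2 r))
      by (apply Rmult_le_compat_r; lra).
    assert (0 < q / 2 * (W r - (E1 r + E2 r))) by (apply Rmult_lt_0_compat; lra).
    lra.
Qed.

Lemma exp_neg_small (g x e : R) : 0 < g -> 0 < e -> exists n : nat, exp (- g * (x + INR n)) < e.
Proof.
  intros Hg He. destruct (nfloor_ex (Rmax 0 (- ln e / g - x))) as [n Hn]; [apply Rmax_l|].
  exists (S n). rewrite S_INR. rewrite <- (exp_ln e He) at 1. apply exp_increasing.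
  assert (Hm := Rmax_r 0 (- ln e / g - x)).
  assert (Hx : - ln e / g < x + (INR n + 1)) by lra.
  apply (Rmult_lt_compat_l g) in Hx; [|assumption].
  replace (g * (- ln e / g)) with (- ln e) in Hx by (field; lra). lra.
Qed.

Lemma finite_profile {q s K : R} {F : R -> R} (H : bistable q s K F) (k b : R) :
  exists U U1 : R -> R, profile k q s F b U U1.
Proof.
  assert (Hq := bistable_q _ _ _ _ H). assert (Hs := bistable_s _ _ _ _ H).
  assert (HK := bistable_K _ _ _ _ H).
  (* All intervals contain [b - 1, b], where a bound uniform in [n] is needed to keep the value at
     [b]. *)
  set (a := fun n : nat => b - 1 - INR n).
  assert (Hab : forall n, a n <= b - 1) by (intros n; unfold a; assert (Hn := pos_INR n); lra).
  destruct (functional_choice (fun n (p : (R -> R) * (R -> R)) =>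
    (forall t, a n <= t <= b -> log_ode k q F (fst p) (snd p) t /\ 0 <= fst p t <= s) /\
    fst p (a n) = s /\ fst p b = s /\
    (forall W W1 : R -> R,
       (forall t, a n <= t <= b -> log_ode k q F W W1 t /\ 0 <= W t <= s) ->
       forall t, a n <= t <= b -> W t <= fst p t))) as [v Hv].
  { intros n. destruct (dirichlet_maximal_solution H k (a n) b) as [V [V1 HV]].
    - specialize (Hab n). lra.
    - now exists (V, V1). }
  set (I := fun n t => a n < t < b).
  assert (HI : forall n t, I n t -> I (S n) t).
  { intros n t. unfold I, a. rewrite S_INR. lra. }
  assert (Hnear : forall t, t < b -> exists n, a n < t).
  { intros t Ht. destruct (nfloor_ex (b - t)) as [n Hn]; [lra|].
    exists n. unfold a. lra. }
  destruct (exhausting_limit_solution H k b I (fun n => fst (v n)) (fun n => snd (v n)) HI)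
    as [U HU].
  - intros t Ht. destruct (Hnear t Ht) as [n Hn]. exists n, (a n), b. split; [split; assumption|].
    intros r Hr. exact Hr.
  - intros n t Ht. apply Hv. unfold I in Ht. lra.
  (* The solution on the larger interval is a competitor on the smaller one, so maximality makes the
     sequence decrease. *)
  - intros n t Ht. apply (proj2 (proj2 (proj2 (Hv n))) (fst (v (S n))) (snd (v (S n)))).
    + intros r Hr. apply Hv. unfold a in *. rewrite S_INR. lra.
    + unfold I in Ht. lra.
  - exists U, (Derive U). split.
    + intros t Ht. apply (HU t Ht).
    + intros t Ht. apply (HU t Ht).
    + set (g := Rmin 1 (q / 2 / (1 + Rabs k))).
      assert (Hk := Rabs_pos k).
      assert (Hg1 := Rmin_l 1 (q / 2 / (1 + Rabs k)) : g <= _).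
      assert (Hg2 := Rmin_r 1 (q / 2 / (1 + Rabs k)) : g <= _).
      assert (Hg : 0 < g) by (apply Rmin_glb_lt; [lra|repeat apply Rdiv_lt_0_compat; lra]).
      assert (Hgk : g * g + Rabs k * g <= q / 2).
      { apply Rle_trans with (g * (1 + Rabs k)); [nra|].
        apply Rle_trans with (q / 2 / (1 + Rabs k) * (1 + Rabs k)).
        - apply Rmult_le_compat_r; lra.
        - right. field. lra. }
      clearbody g.
      (* The right end of the barrier: there [K * exp (2 * ts) <= q / 2]. *)
      set (ts := Rmin (ln (q / 2 / K) / 2) (b - 1)).
      assert (Hts1 := Rmin_l (ln (q / 2 / K) / 2) (b - 1) : ts <= _).
      assert (Hts2 := Rmin_r (ln (q / 2 / K) / 2) (b - 1) : ts <= _).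
      assert (Hts : K * exp (2 * ts) <= q / 2).
      { assert (Hqk : 0 < q / 2 / K) by (repeat apply Rdiv_lt_0_compat; lra).
        apply Rle_trans with (K * exp (ln (q / 2 / K))).
        - apply Rmult_le_compat_l; [lra|]. apply exp_le. lra.
        - rewrite exp_ln by assumption. right. field. lra. }
      assert (Hbound : forall t, t <= ts -> U t <= s * exp (g * (t - ts))).
      { intros t Ht. apply le_epsilon. intros e He.
        destruct (exp_neg_small g (t - b + 1) (e / s)) as [n0 Hn0]; [assumption|now apply Rdiv_lt_0_compat|].
        destruct (Hnear t ltac:(lra)) as [n1 Hn1].
        set (n := Nat.max n0 n1).
        assert (Hnn0 : INR n0 <= INR n) by (apply le_INR; unfold n; lia).
        assert (Hnn1 : INR n1 <= INR n) by (apply le_INR; unfold n; lia).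
        assert (Hn : a n < t) by (unfold a in *; lra).
        destruct (HU t ltac:(simpl; lra)) as [_ [_ [HUn _]]].
        apply Rle_trans with (fst (v n) t); [apply HUn; unfold I; lra|].
        eapply Rle_trans.
        - apply (start_barrier H k g (a n) ts (fst (v n)) (snd (v n))); trivial; try lra.
          intros r Hr. apply Hv. lra.
        - assert (Hexp : exp (- g * (t - a n)) <= e / s); [|].
          { apply Rle_trans with (exp (- g * (t - b + 1 + INR n0))); [|lra].
            apply exp_le. unfold a. nra. }
          assert (s * exp (- g * (t - a n)) <= s * (e / s)) by (apply Rmult_le_compat_l; lra).
          assert (s * (e / s) = e) by (field; lra). lra. }
      intros e He. exists (Rmin ts (ts + ln (e / s) / g)).
      assert (Hm1 := Rmin_l ts (ts + ln (e / s) / g)).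
      assert (Hm2 := Rmin_r ts (ts + ln (e / s) / g)).
      split; [simpl; lra|]. intros t Ht.
      apply Rle_lt_trans with (s * exp (g * (t - ts))); [apply Hbound; lra|].
      apply Rlt_le_trans with (s * exp (ln (e / s))).
      * apply Rmult_lt_compat_l; [assumption|]. apply exp_increasing.
        replace (ln (e / s)) with (g * (ln (e / s) / g)) by (field; lra).
        apply Rmult_lt_compat_l; lra.
      * rewrite exp_ln by now apply Rdiv_lt_0_compat. right. field. lra.
    (* Since every approximation equals [s] at [b], the common Lipschitz constant gives the lower
       bound [s - C * (b - t)], which survives the limit. *)
    + set (C := exp (Rabs k * (b - (b - 1))) *
         (s / (b - (b - 1)) + (q + K * exp (2 * b)) * s * (b - (b - 1)))).
      assert (HVl : forall n t, b - 1 <= t <= b -> s - C * (b - t) <= fst (v n) t).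
      { intros n t Ht. specialize (Hab n).
        assert (HL : Rabs (fst (v n) b - fst (v n) t) <= C * Rabs (b - t)).
        { apply (lipschitz_of_derivative_bound (fst (v n)) (snd (v n)) (b - 1) b); try lra.
          - intros r Hr. apply Hv. lra.
          - apply (log_ode_derivative_bound H k (fst (v n)) (snd (v n)) (b - 1) b); [lra|].
            intros r Hr. apply Hv. lra. }
        rewrite (proj1 (proj2 (proj2 (Hv n)))) in HL.
        rewrite (Rabs_right (b - t)) in HL by lra.
        assert (HL1 := Rle_abs (s - fst (v n) t)). lra. }
      assert (HC : 0 <= C).
      { specialize (HVl 0%nat (b - 1) ltac:(lra)).
        assert (HVs := proj2 (proj1 (Hv 0%nat) (b - 1) ltac:(unfold a; simpl; lra))). lra. }
      intros e He. exists (b - Rmin 1 (e / (C + 1))).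
      assert (Hm1 := Rmin_l 1 (e / (C + 1))). assert (Hm2 := Rmin_r 1 (e / (C + 1))).
      assert (He' : 0 < e / (C + 1)) by (apply Rdiv_lt_0_compat; lra).
      assert (Hm : 0 < Rmin 1 (e / (C + 1))) by (apply Rmin_glb_lt; lra).
      split; [simpl; lra|]. intros t Ht Htb. simpl in Htb.
      destruct (HU t Htb) as [_ [HUr [_ HUl]]].
      specialize (HUl (s - C * (b - t)) 0%nat (fun n _ _ => HVl n t ltac:(lra))).
      assert (C * (b - t) <= C * (e / (C + 1))) by (apply Rmult_le_compat_l; lra).
      assert ((C + 1) * (e / (C + 1)) = e) by (field; lra).
      apply Rabs_def1; lra.
Qed.

(** * Solutions on the whole line *)

Lemma derivative_nonneg_of_nondecreasing (f : R -> R) (x y l : R) :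
  x < y -> is_derive f x l -> (forall t, x < t < y -> f x <= f t) -> 0 <= l.
Proof.
  intros Hxy Hf Hmon. apply Rnot_lt_le. intros Hl.
  destruct (increasing_right_of_positive_derivative (fun t => - f t) x (- l)) as [d [Hd Hinc]].
  - exact (is_derive_opp f x l Hf).
  - lra.
  - assert (Hm1 := Rmin_l d (y - x)). assert (Hm2 := Rmin_r d (y - x)).
    assert (Hm : 0 < Rmin d (y - x)) by (apply Rmin_glb_lt; lra).
    specialize (Hinc (x + Rmin d (y - x) / 2) ltac:(lra)).
    specialize (Hmon (x + Rmin d (y - x) / 2) ltac:(lra)). lra.
Qed.

Lemma nonincreasing_of_derivative (f f1 : R -> R) (x y : R) :
  x <= y -> (forall t, x <= t <= y -> is_derive f t (f1 t) /\ f1 t <= 0) -> f y <= f x.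
Proof.
  intros [Hxy| ->] Hf; [|lra].
  destruct (mean_value f f1 x y Hxy) as [c [Hc Heq]]; [intros t Ht; now apply Hf|].
  destruct (Hf c ltac:(lra)) as [_ Hc1].
  assert (0 <= - f1 c * (y - x)) by (apply Rmult_le_pos; lra). lra.
Qed.

Section Infinite.
Context {k q s K : R} {F : R -> R} (H : bistable q s K F).

Lemma profile_nondecreasing {T : Rbar} {U U1 : R -> R} (P : profile k q s F T U U1) (t r : R) :
  t <= r -> Rbar_lt r T -> U t <= U r.
Proof.
  intros Htr Hr. replace r with (t + (r - t)) by ring.
  apply (profile_comparison H P P (Rbar_le_refl T)); [lra|].
  now replace (t + (r - t)) with r by ring.
Qed.

Lemma profile_derivative_nonneg {T : Rbar} {U U1 : R -> R} (P : profile k q s F T U U1) (t : R) :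
  Rbar_lt t T -> 0 <= U1 t.
Proof.
  intros Ht. destruct (Rbar_lt_between t T Ht) as [y [Hty Hy]].
  apply (derivative_nonneg_of_nondecreasing U t y); [assumption| |].
  - apply (profile_ode _ _ _ _ _ _ _ P t Ht).
  - intros r Hr. apply (profile_nondecreasing P); [lra|]. apply (Rle_Rbar_lt r y); [lra|assumption].
Qed.

Let C := exp (Rabs k) * (s * (1 + q + K)).
Let A := q * s + Rabs (k + 1) * C.

(** In the radial variable this says that u' is bounded. The derivative estimate is used on an
    interval of length [exp (- t)], for which the terms [s / l] and [K * exp (2 * t) * s * l] are
    both of order [exp t]. *)
Lemma profile_derivative_growth {T : Rbar} {U U1 : R -> R} (P : profile k q s F T U U1) (t : R) :
  0 <= t -> Rbar_lt t T -> U1 t <= C * exp t.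
Proof.
  intros Ht HtT.
  assert (Hq := bistable_q _ _ _ _ H). assert (Hs := bistable_s _ _ _ _ H).
  assert (HK := bistable_K _ _ _ _ H).
  assert (HE := exp_pos t). set (l := / exp t).
  assert (Hl : 0 < l) by (apply Rinv_0_lt_compat, HE).
  assert (HE1 : 1 <= exp t) by (rewrite <- exp_0; apply exp_le; lra).
  assert (Hl1 : l <= 1) by (unfold l; rewrite <- Rinv_1; apply Rinv_le_contravar; lra).
  assert (Hb := log_ode_derivative_bound H k U U1 (t - l) t ltac:(lra)).
  assert (Hb' : Rabs (U1 t) <= exp (Rabs k * (t - (t - l))) *
     (s / (t - (t - l)) + (q + K * exp (2 * t)) * s * (t - (t - l)))).
  { apply Hb; [|lra]. intros r Hr.
    assert (Hr' : Rbar_lt r T) by (apply (Rle_Rbar_lt r t); [lra|assumption]).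
    split; [apply (profile_ode _ _ _ _ _ _ _ P r Hr')|apply (profile_range H P r Hr')]. }
  replace (t - (t - l)) with l in Hb' by ring.
  eapply Rle_trans; [apply Rle_abs|]. eapply Rle_trans; [exact Hb'|].
  unfold C. rewrite (Rmult_assoc (exp (Rabs k))). apply Rmult_le_compat.
  - apply Rlt_le, exp_pos.
  - apply Rplus_le_le_0_compat; [apply Rlt_le, Rdiv_lt_0_compat; assumption|].
    assert (He2 := exp_pos (2 * t)).
    apply Rmult_le_pos; [|lra]. apply Rmult_le_pos; [|lra].
    assert (0 < K * exp (2 * t)) by (apply Rmult_lt_0_compat; assumption). lra.
  - apply exp_le. assert (Hk := Rabs_pos k). nra.
  - replace (exp (2 * t)) with (exp t * exp t) by (rewrite <- exp_plus; f_equal; ring).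
    replace (s / l + (q + K * (exp t * exp t)) * s * l)
      with (s * exp t + q * s * l + K * s * exp t) by (unfold l; field; lra).
    assert (0 < q * s) by (apply Rmult_lt_0_compat; assumption).
    assert (q * s * l <= q * s * exp t) by (apply Rmult_le_compat_l; lra). lra.
Qed.

(* The energy [exp (-2t) U1^2 / 2 - (RInt F 0 U)] is [u'^2 / 2 - (RInt F 0 u)] in the
   variable [r = exp t]; it varies little for large [t] since [U] is monotone
   and bounded. *)
Let E (U U1 : R -> R) (t : R) := exp (- 2 * t) * (U1 t * U1 t) / 2 - RInt F 0 (U t).

(** The terms in [F] cancel in the derivative of the energy and leave [exp (- 2 * x) * U1 * (q * U -
    (k + 1) * U1)]. The last factor is at most [A * exp x], so for [x >= t] the derivative is at
    most [exp (- t) * A * U1], whose integral is controlled by the total rise of [U]. *)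
Lemma energy_increase {T : Rbar} {U U1 : R -> R} (P : profile k q s F T U U1) (t r : R) :
  0 <= t -> t <= r -> Rbar_lt r T -> E U U1 r <= E U U1 t + exp (- t) * A * s.
Proof.
  intros Ht Htr Hr.
  assert (Hq := bistable_q _ _ _ _ H). assert (Hs := bistable_s _ _ _ _ H).
  assert (HK := bistable_K _ _ _ _ H).
  assert (HC : 0 <= C).
  { apply Rmult_le_pos; [apply Rlt_le, exp_pos|]. apply Rmult_le_pos; lra. }
  assert (HA : 0 <= A).
  { unfold A. assert (Hk := Rabs_pos (k + 1)).
    apply Rplus_le_le_0_compat; apply Rmult_le_pos; lra. }
  assert (Hmon : E U U1 r - exp (- t) * A * U r <= E U U1 t - exp (- t) * A * U t).
  { apply (nonincreasing_of_derivative (fun x => E U U1 x - exp (- t) * A * U x)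
      (fun x => exp (- 2 * x) * U1 x * (q * U x - (k + 1) * U1 x) - exp (- t) * A * U1 x) t r Htr).
    intros x Hx. assert (HxT : Rbar_lt x T) by (apply (Rle_Rbar_lt x r); tauto).
    destruct (profile_ode _ _ _ _ _ _ _ P x HxT) as [HU HU1].
    split.
    - apply (is_derive_minus (E U U1) (fun x => exp (- t) * A * U x)).
      + evar_last.
        * apply (is_derive_minus (fun x => exp (- 2 * x) * (U1 x * U1 x) / 2) (fun x => RInt F 0 (U x))).
          -- apply is_derive_ext with (fun x => / 2 * (exp (- 2 * x) * (U1 x * U1 x))).
             { intros y. simpl. field. }
             apply (is_derive_scal _ _ (/ 2)).
             apply (is_derive_mult (fun x => exp (- 2 * x)) (fun x => U1 x * U1 x)).
             ++ instantiate (1 := - 2 * exp (- 2 * x)). auto_derive; [trivial|ring].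
             ++ apply (is_derive_mult U1 U1); [exact HU1|exact HU1|apply Rmult_comm].
             ++ apply Rmult_comm.
          -- apply (is_derive_comp (fun u => RInt F 0 u) U x).
             ++ apply is_derive_RInt_continuous, (bistable_continuous _ _ _ _ H).
             ++ exact HU.
        * unfold minus, plus, opp, scal, mult; simpl. unfold mult; simpl.
          assert (Hee : exp (- 2 * x) * exp (2 * x) = 1).
          { rewrite <- exp_plus. replace (- 2 * x + 2 * x) with 0 by ring. apply exp_0. }
          set (e1 := exp (- 2 * x)) in *. set (e2 := exp (2 * x)) in *.
          transitivity (e1 * U1 x * (q * U x - (k + 1) * U1 x) + (e1 * e2 - 1) * F (U x) * U1 x);
            [field|rewrite Hee; ring].
      + apply (is_derive_scal U x (exp (- t) * A)). exact HU.
    - assert (HU0 := profile_range H P x HxT).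
      assert (HU10 := profile_derivative_nonneg P x HxT).
      assert (HU1C := profile_derivative_growth P x ltac:(lra) HxT).
      assert (Hbd : q * U x - (k + 1) * U1 x <= A * exp x).
      { assert (H1 : 1 <= exp x) by (rewrite <- exp_0; apply exp_le; lra).
        assert (q * U x <= q * s * exp x).
        { assert (q * U x <= q * s) by (apply Rmult_le_compat_l; lra).
          assert (0 < q * s) by (apply Rmult_lt_0_compat; assumption). nra. }
        assert (Hk := Rle_abs (- (k + 1))). rewrite Rabs_Ropp in Hk.
        assert (- (k + 1) * U1 x <= Rabs (k + 1) * U1 x) by (apply Rmult_le_compat_r; lra).
        assert (Rabs (k + 1) * U1 x <= Rabs (k + 1) * (C * exp x))
          by (apply Rmult_le_compat_l; [apply Rabs_pos|assumption]).
        unfold A. lra. }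
      assert (He := exp_pos (- 2 * x)).
      assert (exp (- 2 * x) * U1 x * (q * U x - (k + 1) * U1 x) <= exp (- 2 * x) * U1 x * (A * exp x)).
      { apply Rmult_le_compat_l; [apply Rmult_le_pos|]; lra. }
      assert (Hee : exp (- 2 * x) * exp x = exp (- x)) by (rewrite <- exp_plus; f_equal; ring).
      assert (Hex : exp (- x) <= exp (- t)) by (apply exp_le; lra).
      assert (exp (- 2 * x) * U1 x * (A * exp x) = exp (- x) * (A * U1 x)) by (rewrite <- Hee; ring).
      assert (exp (- x) * (A * U1 x) <= exp (- t) * (A * U1 x)).
      { apply Rmult_le_compat_r; [apply Rmult_le_pos; assumption|assumption]. }
      lra. }
  assert (HtT : Rbar_lt t T) by (apply (Rle_Rbar_lt t r); assumption).
  assert (HUt := profile_range H P t HtT). assert (HUr := profile_range H P r Hr).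
  assert (exp (- t) * A * (U r - U t) <= exp (- t) * A * s).
  { apply Rmult_le_compat_l; [apply Rmult_le_pos; [apply Rlt_le, exp_pos|assumption]|lra]. }
  lra.
Qed.

(** The point and the bound depend neither on the end point nor on the profile. If [U] were below
    [d] on the whole interval of length [d / c], the energy would force slope at least [c] there,
    and [U] would rise by [d]. *)
Lemma profile_uniform_lower_bound :
  exists t1 d : R, 0 < d /\
    forall (T : Rbar) (U U1 : R -> R), profile k q s F T U U1 -> Rbar_lt t1 T -> d <= U t1.
Proof.
  assert (Hq := bistable_q _ _ _ _ H). assert (Hs := bistable_s _ _ _ _ H).
  set (Phi := fun u => RInt F 0 u : R).
  assert (HPhi : forall u, is_derive Phi u (F u)).
  { intros u. apply is_derive_RInt_continuous, (bistable_continuous _ _ _ _ H). }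
  assert (HPhi0 : Phi 0 = 0) by exact (RInt_point 0 F).
  (* The potential energy at [s]. A quarter is given up near the right end, a quarter along the way
     and a quarter to the potential near 0, which leaves at least [m / 4] of kinetic energy. *)
  set (m := - Phi s).
  assert (Hm : 0 < m).
  { destruct (mean_value Phi F 0 s Hs) as [c [Hc Heq]]; [intros; apply HPhi|].
    assert (HF := bistable_neg _ _ _ _ H c Hc).
    assert (0 < - F c * (s - 0)) by (apply Rmult_lt_0_compat; lra).
    unfold m. lra. }
  assert (Hcont : forall u e, 0 < e -> exists d, 0 < d /\ forall v, Rabs (v - u) < d ->
     Rabs (Phi v - Phi u) < e).
  { intros u e He. destruct (is_derive_continuity_pt _ _ _ (HPhi u) e He) as [d [Hd Hc]].
    exists d. split; [assumption|]. intros v Hv.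
    destruct (Req_dec u v) as [<-|Hne]; [rewrite Rminus_diag, Rabs_R0; assumption|].
    apply (Hc v). split; [split; [exact I|assumption]|assumption]. }
  destruct (Hcont 0 (m / 4) ltac:(lra)) as [d [Hd Hd']].
  destruct (Hcont s (m / 4) ltac:(lra)) as [d1 [Hd1 Hd1']].
  destruct (exp_neg_small 1 0 (m / 4 / (1 + Rabs (A * s)))) as [n Hn]; [lra| |].
  { apply Rdiv_lt_0_compat; [lra|]. assert (Ha := Rabs_pos (A * s)). lra. }
  set (t0 := INR n). assert (Ht0 : 0 <= t0) by apply pos_INR.
  replace (- (1) * (0 + INR n)) with (- t0) in Hn by (unfold t0; ring).
  assert (HA : exp (- t0) * A * s <= m / 4).
  { assert (Ha := Rle_abs (A * s)). assert (Ha0 := Rabs_pos (A * s)).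
    assert (He := exp_pos (- t0)).
    assert (exp (- t0) * (A * s) <= exp (- t0) * (1 + Rabs (A * s))) by (apply Rmult_le_compat_l; lra).
    assert (exp (- t0) * (1 + Rabs (A * s)) <= m / 4 / (1 + Rabs (A * s)) * (1 + Rabs (A * s)))
      by (apply Rmult_le_compat_r; lra).
    replace (m / 4 / (1 + Rabs (A * s)) * (1 + Rabs (A * s))) with (m / 4) in * by (field; lra).
    lra. }
  (* The cap at 1 avoids a square root: [0 <= U1 < c <= 1] gives [U1 * U1 < c <= m / 2]. *)
  set (c := Rmin 1 (m / 2)).
  assert (Hc1 := Rmin_l 1 (m / 2) : c <= _). assert (Hc2 := Rmin_r 1 (m / 2) : c <= _).
  assert (Hc : 0 < c) by (apply Rmin_glb_lt; lra).
  assert (Hdc : 0 < d / c) by (apply Rdiv_lt_0_compat; assumption).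
  exists (t0 + d / c), d. split; [assumption|]. intros T U U1 P HT.
  assert (Henergy : forall t, t0 <= t -> Rbar_lt t T -> m / 2 <= E U U1 t).
  { intros t Ht HtT.
    destruct (profile_end _ _ _ _ _ _ _ P d1 Hd1) as [x [Hx HxU]].
    destruct (Rbar_lt_between (Rmax x t) T) as [r [Hr HrT]]; [now apply Rmax_case|].
    assert (Hr1 := Rmax_l x t). assert (Hr2 := Rmax_r x t).
    assert (HP := Hd1' _ (HxU r ltac:(lra) HrT)). apply Rabs_def2 in HP.
    assert (HE := energy_increase P t r ltac:(lra) ltac:(lra) HrT).
    assert (HEr : 3 * m / 4 <= E U U1 r).
    { assert (Hsq : 0 <= exp (- 2 * r) * (U1 r * U1 r)).
      { apply Rmult_le_pos; [apply Rlt_le, exp_pos|apply Rle_0_sqr]. }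
      unfold E. fold (Phi (U r)). unfold m in *. lra. }
    assert (exp (- t) * (A * s) <= m / 4); [|lra].
    assert (HAs : 0 <= A * s \/ A * s < 0) by lra. destruct HAs as [HAs|HAs].
    - assert (exp (- t) * (A * s) <= exp (- t0) * (A * s)); [|lra].
      apply Rmult_le_compat_r; [assumption|]. apply exp_le. lra.
    - assert (He := exp_pos (- t)). nra. }
  apply Rnot_lt_le. intros Hlt.
  assert (HU1 : forall t, t0 <= t <= t0 + d / c -> c <= U1 t).
  { intros t Ht. assert (HtT : Rbar_lt t T) by (apply (Rle_Rbar_lt t (t0 + d / c)); tauto).
    assert (HUt : U t < d).
    { apply Rle_lt_trans with (U (t0 + d / c)); [|assumption].
      apply (profile_nondecreasing P); tauto. }
    assert (HU0 := profile_nonneg _ _ _ _ _ _ _ P t HtT).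
    assert (HP : Rabs (Phi (U t) - Phi 0) < m / 4) by (apply Hd'; rewrite Rminus_0_r; apply Rabs_def1; lra).
    rewrite HPhi0, Rminus_0_r in HP. apply Rabs_def2 in HP.
    assert (HE := Henergy t ltac:(lra) HtT). unfold E in HE. fold (Phi (U t)) in HE.
    assert (He : exp (- 2 * t) <= 1) by (rewrite <- exp_0; apply exp_le; lra).
    assert (He0 := exp_pos (- 2 * t)).
    assert (HU10 := profile_derivative_nonneg P t HtT).
    assert (exp (- 2 * t) * (U1 t * U1 t) <= 1 * (U1 t * U1 t)).
    { apply Rmult_le_compat_r; [apply Rle_0_sqr|assumption]. }
    apply Rnot_lt_le. intros Hcc.
    assert (U1 t * U1 t < c) by nra. lra. }
  destruct (mean_value U U1 t0 (t0 + d / c)) as [x [Hx Heq]]; [lra| |].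
  { intros r Hr. apply (profile_ode _ _ _ _ _ _ _ P).
    apply (Rle_Rbar_lt r (t0 + d / c)); tauto. }
  assert (Hge : c * (d / c) <= U1 x * (d / c)).
  { apply Rmult_le_compat_r; [lra|]. apply HU1. lra. }
  replace (c * (d / c)) with d in Hge by (field; lra).
  replace (t0 + d / c - t0) with (d / c) in Heq by ring.
  assert (HU0 : 0 <= U t0).
  { apply (profile_nonneg _ _ _ _ _ _ _ P). apply (Rle_Rbar_lt t0 (t0 + d / c)); [lra|assumption]. }
  lra.
Qed.

(* If [U] stayed below [s - e], then [F U] would be negative and bounded away
   from 0, so that [U1 + k U] would tend to [- oo]. *)
Lemma solution_tends_to_s (U U1 : R -> R) (t1 d : R) :
  (forall t, log_ode k q F U U1 t /\ 0 <= U t <= s) ->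
  (forall t r, t <= r -> U t <= U r) -> 0 < d -> d <= U t1 ->
  forall e, 0 < e -> exists t0, forall t, t0 < t -> Rabs (U t - s) < e.
Proof.
  intros HU Hmon Hd Hd1 e He.
  assert (Hq := bistable_q _ _ _ _ H). assert (Hs := bistable_s _ _ _ _ H).
  apply NNPP. intros Hn.
  assert (Hle : forall t, U t <= s - e).
  { intros t. apply Rnot_lt_le. intros Hlt. apply Hn. exists t. intros r Hr.
    assert (H1 := Hmon t r ltac:(lra)). assert (H2 := proj2 (HU r)). apply Rabs_def1; lra. }
  destruct (continuity_ab_maj F d (s - e)) as [x [HF Hx]].
  { specialize (Hle t1). lra. }
  { intros u Hu. apply continuity_pt_filterlim, (bistable_continuous _ _ _ _ H). }
  assert (HFx := bistable_neg _ _ _ _ H x ltac:(lra)).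
  set (c := - F x). assert (Hc : 0 < c) by (unfold c; lra).
  destruct (exp_neg_small 2 t1 (c / (q * s + 1))) as [n Hn']; [lra| |].
  { assert (0 < q * s) by (apply Rmult_lt_0_compat; assumption). apply Rdiv_lt_0_compat; lra. }
  (* From [t2] on the nonlinear term is at most [- (q * s + 1)], so [U1 + k * U] has slope at most
     -1. *)
  set (t2 := t1 + INR n) in *.
  assert (Ht2 : t1 <= t2) by (unfold t2; assert (Hp := pos_INR n); lra).
  assert (Hlarge : forall t, t2 <= t -> q * s + 1 <= c * exp (2 * t)).
  { intros t Ht.
    assert (H0 : 0 < q * s + 1) by (assert (0 < q * s) by (apply Rmult_lt_0_compat; assumption); lra).
    apply Rle_trans with (c * exp (2 * t2)).
    - replace (q * s + 1) with ((q * s + 1) * (exp (- 2 * t2) * exp (2 * t2))).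
      + apply Rle_trans with ((q * s + 1) * (c / (q * s + 1) * exp (2 * t2))).
        * apply Rmult_le_compat_l; [lra|]. apply Rmult_le_compat_r; [apply Rlt_le, exp_pos|].
          replace (- 2 * t2) with (- (2) * t2) by ring. lra.
        * right. field. lra.
      + rewrite <- exp_plus. replace (- 2 * t2 + 2 * t2) with 0 by ring. rewrite exp_0. ring.
    - apply Rmult_le_compat_l; [lra|]. apply exp_le. lra. }
  (* Late enough for that decrease to exceed [Rabs (U1 t2)] plus the largest variation of [k * U],
     against [U1 t3 >= 0]. *)
  set (t3 := t2 + (Rabs (U1 t2) + 2 * (Rabs k * s) + 1)).
  assert (Hks : 0 <= Rabs k * s) by (apply Rmult_le_pos; [apply Rabs_pos|lra]).
  assert (Habs := Rabs_pos (U1 t2)).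
  assert (Hdec : U1 t3 + k * U t3 + t3 <= U1 t2 + k * U t2 + t2).
  { apply (nonincreasing_of_derivative (fun t => U1 t + k * U t + t)
     (fun t => q * U t + exp (2 * t) * F (U t) + 1)); [unfold t3; lra|].
    intros t Ht. destruct (HU t) as [[HU1 HU2] HUt]. split.
    - evar_last.
      + apply (is_derive_plus (fun t => U1 t + k * U t) (fun t => t)).
        * apply (is_derive_plus U1 (fun t => k * U t)); [exact HU2|].
          apply (is_derive_scal U t k). exact HU1.
        * apply is_derive_id.
      + unfold plus, one; simpl. ring.
    - assert (HFU : F (U t) <= - c).
      { unfold c. rewrite Ropp_involutive. apply HF. split; [|apply Hle].
        apply Rle_trans with (U t1); [assumption|]. apply Hmon. lra. }
      assert (Hlt := Hlarge t ltac:(lra)). assert (Hep := exp_pos (2 * t)).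
      assert (exp (2 * t) * F (U t) <= exp (2 * t) * - c) by (apply Rmult_le_compat_l; lra).
      assert (q * U t <= q * s) by (apply Rmult_le_compat_l; lra). lra. }
  assert (HU13 : 0 <= U1 t3).
  { apply (derivative_nonneg_of_nondecreasing U t3 (t3 + 1)); [lra|apply HU|].
    intros r Hr. apply Hmon. lra. }
  assert (Hk : forall t, Rabs (k * U t) <= Rabs k * s).
  { intros t. rewrite Rabs_mult. apply Rmult_le_compat_l; [apply Rabs_pos|].
    destruct (HU t) as [_ HUt]. rewrite Rabs_right; lra. }
  assert (Hk2 := Hk t2). assert (Hk3 := Hk t3).
  apply Rabs_le_between in Hk2. apply Rabs_le_between in Hk3.
  assert (HUa := Rle_abs (U1 t2)). unfold t3 in *. lra.
Qed.

Lemma infinite_profile : exists U U1 : R -> R, profile k q s F p_infty U U1.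
Proof.
  destruct (functional_choice (fun n (p : (R -> R) * (R -> R)) =>
    profile k q s F (INR n) (fst p) (snd p))) as [v Hv].
  { intros n. destruct (finite_profile H k (INR n)) as [U [U1 P]]. now exists (U, U1). }
  destruct (exhausting_limit_solution H k p_infty (fun n t => t < INR n)
    (fun n => fst (v n)) (fun n => snd (v n))) as [U HU].
  - intros n t Ht. rewrite S_INR. lra.
  - intros t _. destruct (nfloor_ex (Rmax 0 t)) as [n Hn]; [apply Rmax_l|].
    assert (Hm := Rmax_r 0 t).
    exists (S n), (t - 1), (INR (S n)). split; [rewrite S_INR; lra|]. intros r Hr. lra.
  - intros n t Ht. split; [apply (profile_ode _ _ _ _ _ _ _ (Hv n) t Ht)|].
    apply (profile_range H (Hv n) t Ht).
  - intros n t Ht.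
    assert (Hle : Rbar_le (INR n) (INR (S n))) by (rewrite S_INR; simpl; lra).
    assert (Hc := profile_comparison H (Hv n) (Hv (S n)) Hle t 0 (Rle_refl 0)).
    rewrite Rplus_0_r in Hc. now apply Hc.
  - assert (Hmon : forall t r, t <= r -> U t <= U r).
    { intros t r Htr. apply (proj2 (proj2 (proj2 (HU r I))) (U t) 0%nat).
      intros n _ Hn. apply Rle_trans with (fst (v n) t).
      - apply (HU t I). lra.
      - apply (profile_nondecreasing (Hv n)); assumption. }
    destruct profile_uniform_lower_bound as [t1 [d [Hd Hlow]]].
    assert (Hdt : d <= U t1).
    { apply (proj2 (proj2 (proj2 (HU t1 I))) d 0%nat). intros n _ Hn.
      exact (Hlow (INR n) _ _ (Hv n) Hn). }
    exists U, (Derive U). split.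
    + intros t _. apply (HU t I).
    + intros t _. apply (HU t I).
    (* The limit lies below the first approximation and inherits its decay at -oo. *)
    + intros e He. destruct (profile_start _ _ _ _ _ _ _ (Hv 0%nat) e He) as [t0 [Ht0 Hst]].
      exists t0. split; [exact I|]. intros t Ht.
      apply Rle_lt_trans with (fst (v 0%nat) t); [|now apply Hst].
      apply (HU t I). simpl in Ht0 |- *. lra.
    + intros e He.
      destruct (solution_tends_to_s U (Derive U) t1 d) with (e := e) as [t0 Ht0]; trivial.
      * intros t. split; apply (HU t I).
      * exists t0. split; [exact I|]. intros t Ht _. now apply Ht0.
Qed.
End Infinite.

(** * Return to the radial variable *)

Definition log_end (b : Rbar) : Rbar :=
  match b with Finite x => Finite (ln x) | p_infty => p_infty | m_infty => m_infty end.

Lemma log_end_exp (b : Rbar) (t : R) :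
  Rbar_lt 0 b -> Rbar_lt t (log_end b) -> in_interval b (exp t).
Proof.
  intros Hb Ht. split; [apply exp_pos|].
  destruct b as [b| |]; simpl in *; trivial.
  rewrite <- (exp_ln b Hb). now apply exp_increasing.
Qed.

Lemma log_end_ln (b : Rbar) (r : R) : in_interval b r -> Rbar_lt (ln r) (log_end b).
Proof.
  intros [Hr Hrb]. destruct b as [b| |]; simpl in *; trivial. now apply ln_increasing.
Qed.

Lemma in_interval_locally (b : Rbar) (r : R) :
  in_interval b r -> locally r (in_interval b).
Proof.
  intros [Hr Hrb]. destruct (Rbar_lt_ball r b Hrb) as [d [Hd Hball]].
  assert (Hm : 0 < Rmin d r) by now apply Rmin_glb_lt.
  exists (mkposreal _ Hm). intros y Hy. change (Rabs (y - r) < Rmin d r) in Hy.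
  assert (H1 := Rmin_l d r). assert (H2 := Rmin_r d r). split.
  - apply Rabs_def2 in Hy. lra.
  - apply Hball. lra.
Qed.

Lemma profile_of_solution (b : Rbar) (s p q : R) (F v : R -> R) :
  Rbar_lt 0 b -> is_nonneg_solution b s p q F v ->
  profile (p - 1) q s F (log_end b) (fun t => v (exp t)) (fun t => exp t * Derive v (exp t)).
Proof.
  intros Hb [[HC2 [Hode [H0 H1]]] Hnn]. split.
  - intros t Ht. assert (Hin := log_end_exp b t Hb Ht).
    destruct (HC2 _ Hin) as [Hd1 [Hd2 _]]. specialize (Hode _ Hin).
    apply Derive_correct in Hd1. apply Derive_correct in Hd2.
    assert (Hexp := is_derive_exp t). split.
    + exact (is_derive_comp v exp t _ _ Hd1 Hexp).
    + evar_last.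
      * exact (is_derive_mult exp (fun t => Derive v (exp t)) t _ _ Hexp
          (is_derive_comp (Derive v) exp t _ _ Hd2 Hexp) Rmult_comm).
      * unfold plus, mult, scal; simpl. unfold mult; simpl.
        assert (He := exp_pos t).
        replace (exp (2 * t)) with (exp t * exp t) by (rewrite <- exp_plus; f_equal; ring).
        rewrite <- Hode. field. lra.
  - intros t Ht. now apply Hnn, log_end_exp.
  - intros e He.
    destruct (H0 (fun y => Rabs (y - 0) < e)) as [d Hd].
    { exists (mkposreal e He). intros y Hy. exact Hy. }
    assert (Hx : exists x : R, Rbar_lt x (log_end b)).
    { destruct b as [b| |]; [|now exists 0|easy]. exists (ln b - 1). simpl. lra. }
    destruct Hx as [x Hx].
    exists (Rmin x (ln d)). split; [apply (Rle_Rbar_lt _ x); [apply Rmin_l|assumption]|].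
    intros t Ht. assert (Hm2 := Rmin_r x (ln d)).
    assert (He1 : exp t < d).
    { rewrite <- (exp_ln d (cond_pos d)). apply exp_increasing. lra. }
    assert (He0 := exp_pos t).
    specialize (Hd (exp t)). simpl in Hd.
    assert (Hv : Rabs (v (exp t) - 0) < e).
    { apply Hd; [|assumption]. change (Rabs (exp t - 0) < d). apply Rabs_def1; lra. }
    apply Rabs_def2 in Hv. lra.
  - intros e He.
    assert (Hs : left_of b (fun r => Rabs (v r - s) < e)).
    { apply (H1 (fun y => Rabs (y - s) < e)). exists (mkposreal e He). intros y Hy. exact Hy. }
    unfold left_of, within in Hs. destruct b as [b| |]; [| |easy].
    + destruct Hs as [d Hd]. simpl in Hb.
      (* The bound [b / 2] keeps [x] positive, so that [ln x] is meaningful. *)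
      set (x := Rmax (b / 2) (b - d)).
      assert (Hx1 := Rmax_l (b / 2) (b - d) : _ <= x).
      assert (Hx2 := Rmax_r (b / 2) (b - d) : _ <= x).
      assert (Hd0 := cond_pos d).
      assert (Hx : x < b) by (apply Rmax_lub_lt; lra).
      exists (ln x). split; [apply ln_increasing; lra|].
      intros t Ht HtT. assert (Hin := log_end_exp b t Hb HtT). destruct Hin as [_ Hin].
      apply Hd; [|exact Hin]. simpl in Hin.
      assert (Hxt : x < exp t).
      { rewrite <- (exp_ln x) by lra. now apply exp_increasing. }
      change (Rabs (exp t - b) < d). apply Rabs_def1; lra.
    + destruct Hs as [M HM]. exists (ln (Rmax 1 M)). split; [exact I|].
      intros t Ht _. apply HM; [|exact I].
      assert (Hm1 := Rmax_l 1 M). assert (Hm2 := Rmax_r 1 M).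
      apply Rle_lt_trans with (Rmax 1 M); [assumption|].
      rewrite <- (exp_ln (Rmax 1 M)) by lra. now apply exp_increasing.
Qed.

Lemma solution_of_profile {q s K : R} {F : R -> R} (H : bistable q s K F)
  (b : Rbar) (p : R) (U U1 : R -> R) :
  Rbar_lt 0 b -> profile (p - 1) q s F (log_end b) U U1 ->
  is_nonneg_solution b s p q F (fun r => U (ln r)).
Proof.
  intros Hb P.
  (* The second derivative in [r], namely [(U'' - U') / r ^ 2] with [U''] eliminated by the
     equation; in this form it is visibly continuous. *)
  set (D2 := fun r => (q * U (ln r) + r ^ 2 * F (U (ln r)) - p * U1 (ln r)) / r ^ 2).
  assert (HU : forall r, in_interval b r ->
    is_derive (fun r => U (ln r)) r (U1 (ln r) / r) /\
    is_derive (fun r => U1 (ln r)) r ((q * U (ln r) + r ^ 2 * F (U (ln r)) - (p - 1) * U1 (ln r)) / r)).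
  { intros r Hin. assert (Hr := proj1 Hin).
    destruct (profile_ode _ _ _ _ _ _ _ P _ (log_end_ln b r Hin)) as [HU HU1].
    assert (Hln := is_derive_ln r Hr). split.
    - evar_last; [exact (is_derive_comp U ln r _ _ HU Hln)|].
      unfold scal; simpl. unfold mult; simpl. unfold Rdiv. ring.
    - evar_last; [exact (is_derive_comp U1 ln r _ _ HU1 Hln)|].
      unfold scal; simpl. unfold mult; simpl.
      replace (exp (2 * ln r)) with (r * r).
      + field. lra.
      + replace (2 * ln r) with (ln r + ln r) by ring. rewrite exp_plus, exp_ln; trivial. }
  assert (Hd1 : forall r, in_interval b r -> Derive (fun r => U (ln r)) r = U1 (ln r) / r).
  { intros r Hin. apply is_derive_unique, HU, Hin. }
  assert (Hd2 : forall r, in_interval b r ->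
    is_derive (Derive (fun r => U (ln r))) r (D2 r)).
  { intros r Hin. assert (Hr := proj1 Hin).
    apply (is_derive_ext_loc (fun r => U1 (ln r) / r)).
    - apply (filter_imp (in_interval b)); [|now apply in_interval_locally].
      intros x Hx. symmetry. now apply Hd1.
    - assert (Hr0 : r <> 0) by lra. assert (Hid : is_derive (fun x : R => x) r 1) by exact (is_derive_id r).
      evar_last; [exact (is_derive_div (fun r => U1 (ln r)) (fun r => r) r _ _
        (proj2 (HU r Hin)) Hid Hr0)|].
      unfold D2. field. lra. }
  assert (Hd2' : forall r, in_interval b r -> Derive (Derive (fun r => U (ln r))) r = D2 r).
  { intros r Hin. now apply is_derive_unique, Hd2. }
  split; [split; [|split; [|split]]|].
  - intros r Hin. destruct (HU r Hin) as [HUd HU1d]. assert (Hr := proj1 Hin).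
    split; [now eexists; eassumption|]. split; [eexists; now apply Hd2|].
    apply (continuous_ext_loc _ D2).
    + apply (filter_imp (in_interval b)); [|now apply in_interval_locally].
      intros x Hx. symmetry. now apply Hd2'.
    + assert (HcU : continuous (fun r => U (ln r)) r) by (apply (ex_derive_continuous (fun r => U (ln r))); now eexists; eassumption).
      assert (HcU1 : continuous (fun r => U1 (ln r)) r) by (apply (ex_derive_continuous (fun r => U1 (ln r))); now eexists; eassumption).
      assert (Hc2 : continuous (fun r : R => r ^ 2) r).
      { apply (ex_derive_continuous (fun r : R => r ^ 2)). auto_derive; trivial. }
      unfold D2, Rdiv.
      apply (continuous_mult (fun r => q * U (ln r) + r ^ 2 * F (U (ln r)) - p * U1 (ln r)) (fun r => / r ^ 2)).
      * apply (continuous_minus (fun r => q * U (ln r) + r ^ 2 * F (U (ln r))) (fun r => p * U1 (ln r))).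
        -- apply (continuous_plus (fun r => q * U (ln r)) (fun r => r ^ 2 * F (U (ln r)))).
           ++ apply (continuous_mult (fun _ => q) (fun r => U (ln r))); [apply continuous_const|assumption].
           ++ apply (continuous_mult (fun r => r ^ 2) (fun r => F (U (ln r)))); [assumption|].
              apply (continuous_comp (fun r => U (ln r)) F); [assumption|apply (bistable_continuous _ _ _ _ H)].
        -- apply (continuous_mult (fun _ => p) (fun r => U1 (ln r))); [apply continuous_const|assumption].
      * apply (continuous_comp (fun r => r ^ 2) Rinv); [assumption|].
        apply continuous_Rinv. apply pow_nonzero. lra.
  - intros r Hin. rewrite Hd2', Hd1 by assumption. unfold D2. field. destruct Hin; lra.
  - intros Q [eps HQ].
    destruct (profile_start _ _ _ _ _ _ _ P eps (cond_pos eps)) as [t0 [Ht0 Hst]].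
    exists (mkposreal (exp t0) (exp_pos t0)). intros r Hr Hr0.
    change (Rabs (r - 0) < exp t0) in Hr. apply Rabs_def2 in Hr.
    assert (Hln : ln r < t0) by (rewrite <- (ln_exp t0); apply ln_increasing; lra).
    apply HQ. change (Rabs (U (ln r) - 0) < eps).
    assert (H0 := profile_nonneg _ _ _ _ _ _ _ P (ln r) (Rle_Rbar_lt _ _ _ (Rlt_le _ _ Hln) Ht0)).
    specialize (Hst _ Hln). apply Rabs_def1; lra.
  - intros Q [eps HQ].
    destruct (profile_end _ _ _ _ _ _ _ P eps (cond_pos eps)) as [t0 [Ht0 Hst]].
    assert (Hgoal : forall r, exp t0 < r -> Rbar_lt r b -> Q (U (ln r))).
    { intros r Hr Hrb. assert (He := exp_pos t0). apply HQ. apply Hst.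
      - rewrite <- (ln_exp t0). now apply ln_increasing.
      - apply log_end_ln. split; [lra|assumption]. }
    unfold left_of, filtermap, within. destruct b as [b| |]; [| |easy].
    + simpl in Hb. assert (Het : exp t0 < b).
      { rewrite <- (exp_ln b Hb). now apply exp_increasing. }
      assert (Hd : 0 < b - exp t0) by lra.
      exists (mkposreal _ Hd). intros r Hr Hrb.
      change (Rabs (r - b) < b - exp t0) in Hr. apply Rabs_def2 in Hr.
      apply Hgoal; [lra|assumption].
    + exists (exp t0). intros r Hr Hrb. now apply Hgoal.
  - intros r Hin. apply (profile_nonneg _ _ _ _ _ _ _ P). now apply log_end_ln.
Qed.

Lemma bistable_of_C1 (s q : R) (F : R -> R) :
  0 < s -> 0 < q -> is_C1 F -> F 0 = 0 -> F s = 0 -> 0 < Derive F s ->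
  (forall t : R, 0 < t < s -> F t < 0) -> (forall t : R, s < t -> 0 <= F t) ->
  exists K, bistable q s K F.
Proof.
  intros Hs Hq HF HF0 HFs HF's Hneg Hpos.
  assert (Hd : forall t, is_derive F t (Derive F t)) by (intros t; apply Derive_correct, HF).
  assert (Hc : forall t, continuity_pt (Derive F) t).
  { intros t. apply continuity_pt_filterlim, HF. }
  destruct (continuity_ab_maj (fun t => Rabs (Derive F t)) 0 s (Rlt_le _ _ Hs)) as [x [Hx _]].
  { intros t _. apply (continuity_pt_comp (Derive F) Rabs); [apply Hc|apply Rcontinuity_abs]. }
  exists (Rabs (Derive F x) + 1). split; trivial.
  - assert (H0 := Rabs_pos (Derive F x)). lra.
  - intros t. apply (ex_derive_continuous F). now exists (Derive F t).
  - intros u v Hu Hv. apply (lipschitz_of_derivative_bound F (Derive F) 0 s); auto.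
    intros t Ht. specialize (Hx t Ht). simpl in Hx. lra.
  - destruct (Hc s (Derive F s) HF's) as [d [Hd0 Hd1]].
    (* Half of the minimum lies strictly below [s] and strictly within the neighbourhood of [s]
       where [Derive F] is positive. *)
    exists (Rmin d s / 2).
    assert (Hm1 := Rmin_l d s). assert (Hm2 := Rmin_r d s).
    assert (Hm : 0 < Rmin d s) by now apply Rmin_glb_lt.
    split; [lra|]. intros u v Hu [Huv|<-] Hv; [|lra].
    destruct (mean_value F (Derive F) u v Huv) as [c [Hc1 Hc2]]; [auto|].
    assert (Hdc : 0 < Derive F c).
    { specialize (Hd1 c). simpl in Hd1. unfold R_dist in Hd1.
      assert (Hab : Rabs (Derive F c - Derive F s) < Derive F s).
      { apply Hd1. split; [split; [exact I|lra]|]. apply Rabs_def1; lra. }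
      apply Rabs_def2 in Hab. lra. }
    assert (0 < Derive F c * (v - u)) by (apply Rmult_lt_0_compat; lra). lra.
Qed.

Theorem theorem1p1 (b : Rbar) (s p q : R) (F : R -> R)
  (hb : Rbar_lt 0 b) (hs : 0 < s) (hq : 0 < q)
  (hF : is_C1 F) (hF0 : F 0 = 0) (hFs : F s = 0) (hF's : 0 < Derive F s)
  (hFneg : forall t : R, 0 < t < s -> F t < 0)
  (hFpos : forall t : R, s < t -> 0 <= F t) :
  exists u : R -> R,
    is_nonneg_solution b s p q F u /\
    (forall v : R -> R, is_nonneg_solution b s p q F v ->
       forall r : R, in_interval b r -> v r = u r) /\
    strictly_increasing_on b u.
Proof.
  destruct (bistable_of_C1 s q F hs hq hF hF0 hFs hF's hFneg hFpos) as [K H].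
  assert (HP : exists U U1, profile (p - 1) q s F (log_end b) U U1).
  { destruct b as [b| |]; [apply (finite_profile H)|apply (infinite_profile H)|easy]. }
  destruct HP as [U [U1 P]].
  exists (fun r => U (ln r)). split; [|split].
  - exact (solution_of_profile H b p U U1 hb P).
  - intros v Hv r Hin. assert (HPv := profile_of_solution b s p q F v hb Hv).
    assert (Ht := log_end_ln b r Hin). assert (Hexp := exp_ln r (proj1 Hin)).
    assert (H1 := profile_comparison H P HPv (Rbar_le_refl _) (ln r) 0 (Rle_refl 0)).
    assert (H2 := profile_comparison H HPv P (Rbar_le_refl _) (ln r) 0 (Rle_refl 0)).
    rewrite Rplus_0_r, Hexp in H1, H2. specialize (H1 Ht). specialize (H2 Ht). lra.
  - intros r1 r2 H1 H2 H12.
    assert (Hln : ln r1 < ln r2) by (apply ln_increasing; [apply H1|assumption]).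
    replace (ln r2) with (ln r1 + (ln r2 - ln r1)) by ring.
    apply (profile_comparison_strict H P P (Rbar_le_refl _)); [lra|].
    replace (ln r1 + (ln r2 - ln r1)) with (ln r2) by ring. now apply log_end_ln.
Qed.
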